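(* Over $\mathsf{RCA}_0$, the following are equivalent: (1) For every $n$, every e-matroid of rank no more than $n$ has a basis. (2) For every $n$, if $G=(V,E)$ is a countable graph such that every collection of $n$ vertices contains at least one pair of vertices connected by a path, then $G$ can be decomposed into its connected components. (3) $\mathsf{I}\Sigma^0_2$, the induction scheme for $\Sigma^0_2$ formulas with set parameters.
   Context: Work in second-order arithmetic. An e-matroid is a pair $(M,e)$ with $M\subseteq\mathbb{N}$ and $e\colon\mathbb{N}\to M^{<\mathbb{N}}$ (finite subsets of $M$) such that: (i) $e(n)\neq\emptyset$ for all $n$; (ii) for all $n$ and all finite $Y\subseteq M$, if $e(n)\subseteq Y$ then $Y=e(m)$ for some $m$; (iii) for all finite $X,Y\subseteq M$, if $|X|<|Y|$ and neither $X$ nor $Y$ is in the range of $e$, then some $y\in Y$ has $X\cup\{y\}$ not in the range of $e$. The rank of $(M,e)$ is no more than $n$ if every subset of $M$ of size $n$ is in the range of $e$. $B\subseteq M$ is independent if $e(n)\not\subseteq B$ for all $n$; $B$ spans $M$ if for each $x\in M\setminus B$ there is $n$ with $e(n)\subseteq B\cup\{x\}$; a basis is an independent spanning set. A decomposition of a graph $G=(V,E)$ into connected components is a function $h\colon V\to\mathbb{N}$ such that for all $u,v\in V$, $h(u)=h(v)$ if and only if $u$ and $v$ are connected by a path in $G$. *)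

(* Defs.v *)
(* Second-order arithmetic with Henkin semantics, in plain Rocq (no library
   beyond the prelude).  Conventions for coding pairs, finite sets and finite
   sequences are those of Simpson, "Subsystems of Second Order Arithmetic",
   Sections I.2 and II.2. *)
Set Implicit Arguments.
Unset Strict Implicit.
Unset Printing Implicit Defensive.

Declare Scope L2_scope.
Delimit Scope L2_scope with L2.

(* The set sort is an arbitrary type with a membership relation, hence neither
   extensional nor full; equality of sets is not a primitive of L_2. *)
Record L2structure : Type := MkL2 {
  num :> Type;
  pset : Type;
  zero : num;
  one : num;
  add : num -> num -> num;
  mul : num -> num -> num;
  lt : num -> num -> Prop;
  mem : num -> pset -> Prop
}.

Arguments zero {_}.
Arguments one {_}.
Arguments add {_} _ _.
Arguments mul {_} _ _.
Arguments lt {_} _ _.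
Arguments mem {_} _ _.

Notation "0" := zero : L2_scope.
Notation "1" := one : L2_scope.
Notation "x + y" := (add x y) : L2_scope.
Notation "x * y" := (mul x y) : L2_scope.
Notation "x < y" := (lt x y) : L2_scope.
Notation "x \in A" := (mem x A) (at level 70, no associativity) : L2_scope.
Local Open Scope L2_scope.

(* Formulas of L_2, with de Bruijn indices, separately for the two sorts.
   In [BAll t phi] and [BEx t phi] (for all / some n < t, phi) the bound [t]
   is outside the scope of the quantifier. *)
Inductive term : Type :=
| Var (i : nat)
| Zero
| One
| Add (s t : term)
| Mul (s t : term).

Inductive formula : Type :=
| Eq (s t : term)
| Lt (s t : term)
| Mem (t : term) (A : nat)
| Not (phi : formula)
| And (phi psi : formula)
| Or (phi psi : formula)
| Imp (phi psi : formula)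
| BAll (t : term) (phi : formula)
| BEx (t : term) (phi : formula)
| All (phi : formula)
| Ex (phi : formula)
| SetAll (phi : formula)
| SetEx (phi : formula).

Definition scons (T : Type) (x : T) (rho : nat -> T) (i : nat) : T :=
  match i with
  | O => x
  | S j => rho j
  end.

Fixpoint eval (M : L2structure) (rho : nat -> num M) (t : term) : num M :=
  match t with
  | Var i => rho i
  | Zero => 0
  | One => 1
  | Add s t => eval rho s + eval rho t
  | Mul s t => eval rho s * eval rho t
  end.

Fixpoint sat (M : L2structure) (rho : nat -> num M) (sigma : nat -> pset M)
    (phi : formula) : Prop :=
  match phi with
  | Eq s t => eval rho s = eval rho t
  | Lt s t => eval rho s < eval rho t
  | Mem t A => eval rho t \in sigma A
  | Not phi => ~ sat rho sigma phi
  | And phi psi => sat rho sigma phi /\ sat rho sigma psi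
  | Or phi psi => sat rho sigma phi \/ sat rho sigma psi
  | Imp phi psi => sat rho sigma phi -> sat rho sigma psi
  | BAll t phi => forall n : M, n < eval rho t -> sat (scons n rho) sigma phi
  | BEx t phi => exists n : M, n < eval rho t /\ sat (scons n rho) sigma phi
  | All phi => forall n : M, sat (scons n rho) sigma phi
  | Ex phi => exists n : M, sat (scons n rho) sigma phi
  | SetAll phi => forall A : pset M, sat rho (scons A sigma) phi
  | SetEx phi => exists A : pset M, sat rho (scons A sigma) phi
  end.

Fixpoint bounded (phi : formula) : Prop :=
  match phi with
  | Eq _ _ | Lt _ _ | Mem _ _ => True
  | Not phi | BAll _ phi | BEx _ phi => bounded phi
  | And phi psi | Or phi psi | Imp phi psi => bounded phi /\ bounded psi
  | All _ | Ex _ | SetAll _ | SetEx _ => False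
  end.

Inductive Sigma0 : nat -> formula -> Prop :=
| Sigma0_bounded phi : bounded phi -> Sigma0 O phi
| Sigma0_Ex k phi : Pi0 k phi -> Sigma0 (S k) (Ex phi)
with Pi0 : nat -> formula -> Prop :=
| Pi0_bounded phi : bounded phi -> Pi0 O phi
| Pi0_All k phi : Sigma0 k phi -> Pi0 (S k) (All phi).

Record basic_axioms (M : L2structure) : Prop := {
  succ_neq0 : forall n : M, n + 1 <> 0;
  succ_inj : forall m n : M, m + 1 = n + 1 -> m = n;
  add_zero : forall m : M, m + 0 = m;
  add_succ : forall m n : M, m + (n + 1) = (m + n) + 1;
  mul_zero : forall m : M, m * 0 = 0;
  mul_succ : forall m n : M, m * (n + 1) = m * n + m;
  lt_zero : forall m : M, ~ m < 0;
  lt_succ : forall m n : M, m < n + 1 <-> (m < n \/ m = n)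
}.

(* The valuations supply the number and set parameters of the schemes; the
   induction (or comprehension) variable is number variable 0. *)
Definition ISigma0 (k : nat) (M : L2structure) : Prop :=
  forall (phi : formula) (rho : nat -> num M) (sigma : nat -> pset M),
    Sigma0 k phi ->
    sat (scons 0 rho) sigma phi ->
    (forall n : M, sat (scons n rho) sigma phi ->
                   sat (scons (n + 1) rho) sigma phi) ->
    forall n : M, sat (scons n rho) sigma phi.

Definition Delta01_comprehension (M : L2structure) : Prop :=
  forall (phi psi : formula) (rho : nat -> num M) (sigma : nat -> pset M),
    Sigma0 1 phi -> Pi0 1 psi ->
    (forall n : M, sat (scons n rho) sigma phi <->
                   sat (scons n rho) sigma psi) ->
    exists A : pset M, forall n : M, n \in A <-> sat (scons n rho) sigma phi.

Record RCA0 (M : L2structure) : Prop := {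
  RCA0_basic : basic_axioms M;
  RCA0_induction : ISigma0 1 M;
  RCA0_comprehension : Delta01_comprehension M
}.

(* All notions below are internal: "number", "finite set", "sequence" and
   "function" refer to elements of [M] and their codes, never to [nat].  Meta
   predicates [num M -> Prop] are used only as abbreviations for L_2-formulas. *)

Definition pair (M : L2structure) (i j : M) : M := (i + j) * (i + j) + i.

Definition divides (M : L2structure) (d n : M) : Prop :=
  exists q : M, n = d * q.

(* c = (k, (m, n)) represents { i < k : m(i+1)+1 divides n }. *)
Definition fin_mem (M : L2structure) (c i : M) : Prop :=
  exists k m n : M,
    c = pair k (pair m n) /\ i < k /\ divides (m * (i + 1) + 1) n.

Definition triple (M : L2structure) (c : M) : Prop :=
  exists k m n : M, c = pair k (pair m n).

Definition fin_code (M : L2structure) (c : M) : Prop :=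
  triple c /\
  forall d : M, d < c -> triple d -> ~ (forall i, fin_mem d i <-> fin_mem c i).

Definition fin_sub (M : L2structure) (c : M) (P : num M -> Prop) : Prop :=
  fin_code c /\ forall i : M, fin_mem c i -> P i.

(* [s] codes a finite sequence of length [l], i.e. the graph of a function
   with domain {i : i < l}. *)
Definition fin_seq (M : L2structure) (s l : M) : Prop :=
  fin_code s /\
  (forall z : M, fin_mem s z -> exists i j : M, z = pair i j) /\
  (forall i j k : M, fin_mem s (pair i j) -> fin_mem s (pair i k) -> j = k) /\
  (forall i : M, i < l <-> exists j : M, fin_mem s (pair i j)).

Definition card (M : L2structure) (c n : M) : Prop :=
  exists s : M,
    fin_seq s n /\
    (forall i j k : M, fin_mem s (pair i k) -> fin_mem s (pair j k) -> i = j) /\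
    (forall k : M, fin_mem c k <-> exists i : M, fin_mem s (pair i k)).

Definition card_lt (M : L2structure) (c d : M) : Prop :=
  exists m n : M, card c m /\ card d n /\ m < n.

Definition subset (M : L2structure) (A B : pset M) : Prop :=
  forall i : M, i \in A -> i \in B.

Definition is_fun (M : L2structure) (f : pset M) (P Q : num M -> Prop) : Prop :=
  (forall z : M, z \in f -> exists i j : M, P i /\ Q j /\ z = pair i j) /\
  (forall i : M, P i -> exists! j : M, pair i j \in f).

(* [in_range e P]: the finite set { i : P i } is e(n) for some n. *)
Definition in_range (M : L2structure) (e : pset M) (P : num M -> Prop) : Prop :=
  exists n c : M, pair n c \in e /\ forall i : M, fin_mem c i <-> P i.

(* In [ematroid_exchange], y is deliberately not required to lie outside X. *)
Record ematroid (M : L2structure) (E e : pset M) : Prop := {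
  ematroid_fun :
    is_fun e (fun _ => True) (fun c => fin_sub c (fun i => i \in E));
  ematroid_nonempty :
    forall n c : M, pair n c \in e -> exists i : M, fin_mem c i;
  ematroid_upward :
    forall n c Y : M, pair n c \in e -> fin_sub Y (fun i => i \in E) ->
      (forall i : M, fin_mem c i -> fin_mem Y i) -> in_range e (fin_mem Y);
  ematroid_exchange :
    forall X Y : M,
      fin_sub X (fun i => i \in E) -> fin_sub Y (fun i => i \in E) ->
      card_lt X Y ->
      ~ in_range e (fin_mem X) -> ~ in_range e (fin_mem Y) ->
      exists y : M, fin_mem Y y /\
        ~ in_range e (fun i => fin_mem X i \/ i = y)
}.

Definition rank_le (M : L2structure) (E e : pset M) (n : M) : Prop :=
  forall X : M, fin_sub X (fun i => i \in E) -> card X n ->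
    in_range e (fin_mem X).

Definition independent (M : L2structure) (e B : pset M) : Prop :=
  forall n c : M, pair n c \in e -> ~ (forall i : M, fin_mem c i -> i \in B).

Definition spans (M : L2structure) (E e B : pset M) : Prop :=
  forall x : M, x \in E -> ~ x \in B ->
    exists n c : M, pair n c \in e /\
      forall i : M, fin_mem c i -> i \in B \/ i = x.

Definition basis (M : L2structure) (E e B : pset M) : Prop :=
  subset B E /\ independent e B /\ spans E e B.

Definition finite_rank_ematroids_have_bases (M : L2structure) : Prop :=
  forall (n : M) (E e : pset M),
    ematroid E e -> rank_le E e n -> exists B : pset M, basis E e B.

(* An edge {u, v} is represented by the two pairs (u, v) and (v, u). *)
Record graph (M : L2structure) (V E : pset M) : Prop := {
  graph_pairs : forall z : M, z \in E ->
    exists u v : M, u \in V /\ v \in V /\ z = pair u v;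
  graph_sym : forall u v : M, pair u v \in E -> pair v u \in E;
  graph_irrefl : forall u : M, ~ pair u u \in E
}.

(* [s] codes a path s(0) = u, ..., s(l) = v of length l, possibly l = 0. *)
Definition connected (M : L2structure) (V E : pset M) (u v : M) : Prop :=
  exists s l : M,
    fin_seq s (l + 1) /\
    fin_mem s (pair 0 u) /\ fin_mem s (pair l v) /\
    (forall i x : M, fin_mem s (pair i x) -> x \in V) /\
    (forall i x y : M, i < l ->
       fin_mem s (pair i x) -> fin_mem s (pair (i + 1) y) -> pair x y \in E).

Definition decomposition (M : L2structure) (V E h : pset M) : Prop :=
  is_fun h (fun v => v \in V) (fun _ => True) /\
  forall u v a b : M,
    u \in V -> v \in V -> pair u a \in h -> pair v b \in h ->
    (a = b <-> connected V E u v).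

Definition finite_component_graphs_decompose (M : L2structure) : Prop :=
  forall (n : M) (V E : pset M),
    graph V E ->
    (forall X : M, fin_sub X (fun i => i \in V) -> card X n ->
       exists u v : M,
         fin_mem X u /\ fin_mem X v /\ u <> v /\ connected V E u v) ->
    exists h : pset M, decomposition V E h.

(* Main.v *)
(* A Sigma^0_2 statement about i < n can be traded for a Sigma^0_1 one as soon as
   a graph with about n components has been decomposed, and conversely Sigma^0_2
   induction finds the largest independent sets.

   (3) => (1): "some independent set has j elements" is Sigma^0_2 in j, true for
   j = 0 and false at the rank bound, so it fails to pass from some j to j + 1; an
   independent set of that size j is maximal, hence spans.

   (1) => (2): the finite sets of vertices containing two distinct connected
   vertices form an e-matroid; exchange is the pigeonhole principle.  A basis meets
   every component exactly once, and sending a vertex to the basis element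
   connected to it is Delta^0_1.

   (2) => (3): to handle "exists x, for all y, theta(i, x, y)" for i <= N, take as
   vertices the claims (i, x, b) asserting that x is the least witness for i, where
   b bounds refutations of all smaller candidates, together with tokens, all
   adjacent to one another.  Claims with the same i and x are adjacent, and a claim
   is adjacent to the tokens refuting x.  Each i contributes at most one component
   besides that of the tokens, and it does so iff the formula holds at i, which is
   Sigma^0_1 in a decomposition. *)
From Stdlib Require Import Classical Ring.
Require Import Defs.
Set Implicit Arguments.
Unset Strict Implicit.
Unset Printing Implicit Defensive.
Local Open Scope L2_scope.

(** * Renaming *)

(** Fixes the first [k] variables, which are bound or belong to a context, and renames only the
    parameters behind them. *)
Fixpoint lift (k : nat) (f : nat -> nat) (i : nat) : nat :=
  match k, i with
  | O, _ => f i
  | S _, O => O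
  | S k, S i => S (lift k f i)
  end.

Fixpoint rent (f : nat -> nat) (t : term) : term :=
  match t with
  | Var i => Var (f i)
  | Zero => Zero
  | One => One
  | Add s t => Add (rent f s) (rent f t)
  | Mul s t => Mul (rent f s) (rent f t)
  end.

(* Only meaningful on bounded formulas. *)
Fixpoint renf (f q : nat -> nat) (phi : formula) : formula :=
  match phi with
  | Eq s t => Eq (rent f s) (rent f t)
  | Lt s t => Lt (rent f s) (rent f t)
  | Mem t A => Mem (rent f t) (q A)
  | Not phi => Not (renf f q phi)
  | And phi psi => And (renf f q phi) (renf f q psi)
  | Or phi psi => Or (renf f q phi) (renf f q psi)
  | Imp phi psi => Imp (renf f q phi) (renf f q psi)
  | BAll t phi => BAll (rent f t) (renf (lift 1 f) q phi)
  | BEx t phi => BEx (rent f t) (renf (lift 1 f) q phi)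
  | All phi => All phi
  | Ex phi => Ex phi
  | SetAll phi => SetAll phi
  | SetEx phi => SetEx phi
  end.

Lemma eval_rent (M : L2structure) (f : nat -> nat) (rho rho' : nat -> num M) t :
  (forall i, rho' (f i) = rho i) -> eval rho' (rent f t) = eval rho t.
Proof. intros H; induction t; cbn; congruence. Qed.

Lemma bounded_renf phi : forall f q, bounded phi -> bounded (renf f q phi).
Proof. induction phi; cbn; intuition. Qed.

Lemma scons_lift (M : L2structure) (f : nat -> nat) (rho rho' : nat -> num M) n :
  (forall i, rho' (f i) = rho i) ->
  forall i, scons n rho' (lift 1 f i) = scons n rho i.
Proof. intros H [|i]; cbn; auto. Qed.

Lemma sat_renf (M : L2structure) (sigma sigma' : nat -> pset M) (q : nat -> nat) phi :
  (forall A, sigma' (q A) = sigma A) ->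
  forall (f : nat -> nat) (rho rho' : nat -> num M),
  (forall i, rho' (f i) = rho i) -> bounded phi ->
  (sat rho' sigma' (renf f q phi) <-> sat rho sigma phi).
Proof.
intros Hq; induction phi; intros f rho rho' Hf; cbn; intros B; try tauto;
  rewrite ?(eval_rent _ Hf), ?Hq; try tauto.
- rewrite (IHphi _ _ _ Hf B); tauto.
- rewrite (IHphi1 _ _ _ Hf (proj1 B)), (IHphi2 _ _ _ Hf (proj2 B)); tauto.
- rewrite (IHphi1 _ _ _ Hf (proj1 B)), (IHphi2 _ _ _ Hf (proj2 B)); tauto.
- rewrite (IHphi1 _ _ _ Hf (proj1 B)), (IHphi2 _ _ _ Hf (proj2 B)); tauto.
- split; intros H n Hn; specialize (H n Hn);
    apply (IHphi _ _ _ (scons_lift n Hf) B); exact H.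
- split; intros (n & Hn & H); exists n; split; auto;
    apply (IHphi _ _ _ (scons_lift n Hf) B); exact H.
Qed.

(** Merges two assignments into one, at even and odd indices, so that two formulas with separate
    parameters can be combined under a single assignment. *)
Fixpoint interleave (T : Type) (a b : nat -> T) (i : nat) : T :=
  match i with
  | O => a O
  | S O => b O
  | S (S i) => interleave (fun j => a (S j)) (fun j => b (S j)) i
  end.

Fixpoint double (i : nat) : nat :=
  match i with O => O | S i => S (S (double i)) end.

Lemma interleave_double (T : Type) i :
  forall a b : nat -> T, interleave a b (double i) = a i.
Proof. induction i; intros a b; cbn; auto. Qed.

Lemma interleave_double1 (T : Type) i :
  forall a b : nat -> T, interleave a b (S (double i)) = b i.
Proof.
induction i; intros a b; [reflexivity|].
exact (IHi (fun j => a (S j)) (fun j => b (S j))).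
Qed.

(** * Definability with parameters *)

Section Definability.
Variable M : L2structure.

(** The values of the first [k] number variables. All variables behind them are parameters, fixed
    independently of the context. *)
Fixpoint ctx (k : nat) : Type :=
  match k with O => unit | S k => (num M * ctx k)%type end.

Fixpoint env (k : nat) : ctx k -> (nat -> num M) -> nat -> num M :=
  match k with
  | O => fun _ rho => rho
  | S k => fun g rho => scons (fst g) (env (snd g) rho)
  end.

(** Definability is a property of a meta-level function, with the syntax and its parameters
    existentially quantified; closure lemmas then replace writing formulas with de Bruijn
    indices. *)
Definition dterm (k : nat) (f : ctx k -> num M) : Prop :=
  exists t rho, forall g, eval (env g rho) t = f g.

(* An L_2-structure may have no sets, hence no assignment [sigma], at all. *)
Definition delta0 (k : nat) (P : ctx k -> Prop) : Prop :=
  inhabited (pset M) -> exists phi rho sigma, bounded phi /\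
    forall g, sat (env g rho) sigma phi <-> P g.

Lemma env_lift k f (rho rho' : nat -> num M) :
  (forall i, rho' (f i) = rho i) ->
  forall (g : ctx k) i, env g rho' (lift k f i) = env g rho i.
Proof.
intros H; induction k; intros g i; cbn; [apply H|].
destruct i; cbn; auto.
Qed.

Lemma env_lift_left k (rho rho' : nat -> num M) (g : ctx k) i :
  env g (interleave rho rho') (lift k double i) = env g rho i.
Proof. apply env_lift; intros j; apply interleave_double. Qed.

Lemma env_lift_right k (rho rho' : nat -> num M) (g : ctx k) i :
  env g (interleave rho rho') (lift k (fun i => S (double i)) i) = env g rho' i.
Proof. apply env_lift; intros j; apply interleave_double1. Qed.

(** The two contexts may differ in length because, in a bounded quantifier, the bound lives in
    [ctx k] and the body in [ctx (S k)]. *)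
Lemma dterm_merge j k (f : ctx j -> num M) (h : ctx k -> num M) :
  dterm f -> dterm h ->
  exists s t rho, (forall g, eval (env g rho) s = f g) /\
                  (forall g, eval (env g rho) t = h g).
Proof.
intros (s & rho & Hs) (t & rho' & Ht).
exists (rent (lift j double) s), (rent (lift k (fun i => S (double i))) t),
  (interleave rho rho').
split; intros g.
- rewrite <- Hs; apply eval_rent, env_lift_left.
- rewrite <- Ht; apply eval_rent, env_lift_right.
Qed.

Lemma dterm_delta0_merge j k (f : ctx j -> num M) (P : ctx k -> Prop) :
  dterm f -> delta0 P -> inhabited (pset M) ->
  exists t phi rho sigma, bounded phi /\ (forall g, eval (env g rho) t = f g) /\
    (forall g, sat (env g rho) sigma phi <-> P g).
Proof.
intros (s & rho & Hs) HP I.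
destruct (HP I) as (phi & rho' & sigma & B & H).
exists (rent (lift j double) s),
  (renf (lift k (fun i => S (double i))) (fun i => i) phi),
  (interleave rho rho'), sigma.
split; [|split]; [apply bounded_renf, B| |]; intros g.
- rewrite <- Hs; apply eval_rent, env_lift_left.
- rewrite <- H; apply sat_renf; auto using env_lift_right.
Qed.

Lemma delta0_merge j k (P : ctx j -> Prop) (Q : ctx k -> Prop) :
  delta0 P -> delta0 Q -> inhabited (pset M) ->
  exists phi psi rho sigma, bounded phi /\ bounded psi /\
    (forall g, sat (env g rho) sigma phi <-> P g) /\
    (forall g, sat (env g rho) sigma psi <-> Q g).
Proof.
intros HP HQ I.
destruct (HP I) as (phi & rho & sigma & B & H), (HQ I) as (psi & rho' & sigma' & B' & H').
exists (renf (lift j double) double phi),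
  (renf (lift k (fun i => S (double i))) (fun i => S (double i)) psi),
  (interleave rho rho'), (interleave sigma sigma').
split; [|split; [|split]]; try (apply bounded_renf; assumption); intros g.
- rewrite <- H; apply sat_renf;
    auto using env_lift_left, interleave_double.
- rewrite <- H'; apply sat_renf;
    auto using env_lift_right, interleave_double1.
Qed.

Lemma dterm_fst k : dterm (fun g : ctx (S k) => fst g).
Proof. exists (Var O), (fun _ => 0); reflexivity. Qed.

Lemma dterm_snd k (f : ctx k -> num M) :
  dterm f -> dterm (fun g : ctx (S k) => f (snd g)).
Proof.
intros (t & rho & H); exists (rent S t), rho; intros g.
rewrite <- H; apply eval_rent; reflexivity.
Qed.

Lemma env_unused k (c : num M) (g : ctx k) :
  env g (fun _ => c) k = c.
Proof. induction k; cbn; auto. Qed.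

(** The constant becomes a parameter: variable [k] is the first one outside the context. *)
Lemma dterm_const k (c : num M) : dterm (fun _ : ctx k => c).
Proof. exists (Var k), (fun _ => c); intros g; apply env_unused. Qed.

Lemma dterm_add k (f h : ctx k -> num M) :
  dterm f -> dterm h -> dterm (fun g => f g + h g).
Proof.
intros Hf Hh; destruct (dterm_merge Hf Hh) as (s & t & rho & Hs & Ht).
exists (Add s t), rho; intros g; cbn; now rewrite Hs, Ht.
Qed.

Lemma dterm_mul k (f h : ctx k -> num M) :
  dterm f -> dterm h -> dterm (fun g => f g * h g).
Proof.
intros Hf Hh; destruct (dterm_merge Hf Hh) as (s & t & rho & Hs & Ht).
exists (Mul s t), rho; intros g; cbn; now rewrite Hs, Ht.
Qed.

Lemma dterm_pair k (f h : ctx k -> num M) :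
  dterm f -> dterm h -> dterm (fun g => pair (f g) (h g)).
Proof.
intros Hf Hh; exact (dterm_add (dterm_mul (dterm_add Hf Hh) (dterm_add Hf Hh)) Hf).
Qed.

Lemma delta0_ext k (P Q : ctx k -> Prop) :
  (forall g, P g <-> Q g) -> delta0 P -> delta0 Q.
Proof.
intros E HP I; destruct (HP I) as (phi & rho & sigma & B & H).
exists phi, rho, sigma; split; auto.
intros g; rewrite H; apply E.
Qed.

Lemma delta0_eq k (f h : ctx k -> num M) :
  dterm f -> dterm h -> delta0 (fun g => f g = h g).
Proof.
intros Hf Hh [inh]; destruct (dterm_merge Hf Hh) as (s & t & rho & Hs & Ht).
exists (Eq s t), rho, (fun _ => inh); split; [exact Logic.I|].
intros g; cbn; now rewrite Hs, Ht.
Qed.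

Lemma delta0_lt k (f h : ctx k -> num M) :
  dterm f -> dterm h -> delta0 (fun g => f g < h g).
Proof.
intros Hf Hh [inh]; destruct (dterm_merge Hf Hh) as (s & t & rho & Hs & Ht).
exists (Lt s t), rho, (fun _ => inh); split; [exact Logic.I|].
intros g; cbn; now rewrite Hs, Ht.
Qed.

Lemma delta0_mem k (f : ctx k -> num M) (A : pset M) :
  dterm f -> delta0 (fun g => f g \in A).
Proof.
intros (t & rho & Ht) _; exists (Mem t O), rho, (fun _ => A); split; [exact Logic.I|].
intros g; cbn; now rewrite Ht.
Qed.

Lemma delta0_not k (P : ctx k -> Prop) : delta0 P -> delta0 (fun g => ~ P g).
Proof.
intros HP I; destruct (HP I) as (phi & rho & sigma & B & H).
exists (Not phi), rho, sigma; split; auto.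
intros g; cbn; now rewrite H.
Qed.

Lemma delta0_and k (P Q : ctx k -> Prop) :
  delta0 P -> delta0 Q -> delta0 (fun g => P g /\ Q g).
Proof.
intros HP HQ I.
destruct (delta0_merge HP HQ I) as (phi & psi & rho & sigma & B & B' & H & H').
exists (And phi psi), rho, sigma; split; [split; auto|].
intros g; cbn; now rewrite H, H'.
Qed.

Lemma delta0_or k (P Q : ctx k -> Prop) :
  delta0 P -> delta0 Q -> delta0 (fun g => P g \/ Q g).
Proof.
intros HP HQ I.
destruct (delta0_merge HP HQ I) as (phi & psi & rho & sigma & B & B' & H & H').
exists (Or phi psi), rho, sigma; split; [split; auto|].
intros g; cbn; now rewrite H, H'.
Qed.

Lemma delta0_imp k (P Q : ctx k -> Prop) :
  delta0 P -> delta0 Q -> delta0 (fun g => P g -> Q g).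
Proof.
intros HP HQ I.
destruct (delta0_merge HP HQ I) as (phi & psi & rho & sigma & B & B' & H & H').
exists (Imp phi psi), rho, sigma; split; [split; auto|].
intros g; cbn; now rewrite H, H'.
Qed.

Lemma delta0_iff k (P Q : ctx k -> Prop) :
  delta0 P -> delta0 Q -> delta0 (fun g => P g <-> Q g).
Proof. intros HP HQ; exact (delta0_and (delta0_imp HP HQ) (delta0_imp HQ HP)). Qed.

Lemma delta0_ball k (f : ctx k -> num M) (Q : num M -> ctx k -> Prop) :
  dterm f -> delta0 (fun g : ctx (S k) => Q (fst g) (snd g)) ->
  delta0 (fun g => forall n, n < f g -> Q n g).
Proof.
intros Hf HQ I.
destruct (dterm_delta0_merge Hf HQ I) as (t & phi & rho & sigma & B & Ht & H).
exists (BAll t phi), rho, sigma; split; auto.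
intros g; cbn; rewrite Ht; split; intros E n Hn; apply (H (n, g)), E, Hn.
Qed.

Lemma delta0_bex k (f : ctx k -> num M) (Q : num M -> ctx k -> Prop) :
  dterm f -> delta0 (fun g : ctx (S k) => Q (fst g) (snd g)) ->
  delta0 (fun g => exists n, n < f g /\ Q n g).
Proof.
intros Hf HQ I.
destruct (dterm_delta0_merge Hf HQ I) as (t & phi & rho & sigma & B & Ht & H).
exists (BEx t phi), rho, sigma; split; auto.
intros g; cbn; rewrite Ht; split; intros (n & Hn & E); exists n; split; auto;
  apply (H (n, g)), E.
Qed.

End Definability.

Lemma delta0_snd (M : L2structure) k (P : ctx M k -> Prop) :
  delta0 P -> delta0 (fun g : ctx M (S k) => P (snd g)).
Proof.
intros HP I; destruct (HP I) as (phi & rho & sigma & B & H).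
exists (renf S (fun i => i) phi), rho, sigma; split; [apply bounded_renf, B|].
intros g; rewrite <- H; apply sat_renf; auto.
Qed.

(** * Automated proofs of definability *)

Ltac definable_term :=
  cbv beta;
  first [assumption | simple apply dterm_fst |
  lazymatch goal with
  | |- dterm (fun _ => ?c) => apply dterm_const
  | |- dterm (fun g => @?f g + @?h g) =>
      apply (dterm_add (f := f) (h := h)); definable_term
  | |- dterm (fun g => @?f g * @?h g) =>
      apply (dterm_mul (f := f) (h := h)); definable_term
  | |- dterm (fun g => pair (@?f g) (@?h g)) =>
      apply (dterm_pair (f := f) (h := h)); definable_term
  | |- @dterm ?M (S ?k) ?f =>
      (* Here the term should no longer depend on the first coordinate, so a dummy 0 in that place
         recovers it as a function of the remaining context. *)
      let f' := eval cbn [fst snd] in (fun g : ctx M k => f (@zero M, g)) in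
      refine (@dterm_snd M k f' _); definable_term
  end].

Create HintDb definability.
#[local] Hint Extern 1 (dterm _) => definable_term : definability.

(** Follows the connectives and bounded quantifiers down to atoms. Derived notions such as [fin_mem]
    are settled by the hint database, which receives one lemma for each of them. *)
Ltac definable :=
  cbv beta;
  first [assumption |
  lazymatch goal with
  | |- dterm _ => definable_term
  | |- delta0 (fun g => forall n, n < @?t g -> @?Q n g) =>
      apply (delta0_ball (f := t) (Q := Q)); definable
  | |- delta0 (fun g => exists n, n < @?t g /\ @?Q n g) =>
      apply (delta0_bex (f := t) (Q := Q)); definable
  | |- delta0 (fun g => ~ @?P g) => apply (delta0_not (P := P)); definable
  | |- delta0 (fun g => @?P g <-> @?Q g) =>
      apply (delta0_iff (P := P) (Q := Q)); definable
  | |- delta0 (fun g => @?P g /\ @?Q g) =>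
      apply (delta0_and (P := P) (Q := Q)); definable
  | |- delta0 (fun g => @?P g \/ @?Q g) =>
      apply (delta0_or (P := P) (Q := Q)); definable
  | |- delta0 (fun g => @?P g -> @?Q g) =>
      apply (delta0_imp (P := P) (Q := Q)); definable
  | |- delta0 (fun g => @?f g = @?h g) =>
      apply (delta0_eq (f := f) (h := h)); definable
  | |- delta0 (fun g => @?f g < @?h g) =>
      apply (delta0_lt (f := f) (h := h)); definable
  | |- delta0 (fun g => @?f g \in ?A) =>
      apply (delta0_mem (f := f) A); definable
  | |- _ => solve [auto 2 with definability nocore]
  end].

(* Without sets the schemes of RCA_0 say nothing, as their formulas are
   evaluated under an assignment of sets. *)
Class Model (M : L2structure) : Prop := {
  model_RCA0 : RCA0 M;
  model_set : inhabited (pset M)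
}.

(* A notation for [x < y + 1], so that it can bound a quantifier as it stands. *)
Notation "x <= y" := (lt x (add y one)) : L2_scope.

(** * Induction and comprehension for predicates given semantically *)

Section Model.
Context (M : L2structure) {HM : Model M}.

(** The witness is the first argument of [R] because under [Ex] it is variable 0, while the
    induction variable becomes variable 1. *)
Lemma sigma1_induction (R : M -> M -> Prop) :
  delta0 (fun g : ctx M 2 => R (fst g) (fst (snd g))) ->
  (exists x, R x 0) ->
  (forall n, (exists x, R x n) -> exists x, R x (n + 1)) ->
  forall n, exists x, R x n.
Proof.
intros D H0 HS.
destruct (D model_set) as (phi & rho & sigma & B & H).
assert (E : forall n, sat (scons n rho) sigma (Ex phi) <-> exists x, R x n).
{ intros n; cbn; split; intros (x & Hx); exists x; apply (H (x, (n, tt))), Hx. }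
intros n; apply E.
apply (RCA0_induction model_RCA0).
- repeat constructor; assumption.
- now apply E.
- intros m Hm; apply E, HS, E, Hm.
Qed.

Lemma delta0_induction (P : M -> Prop) :
  delta0 (fun g : ctx M 1 => P (fst g)) ->
  P 0 -> (forall n, P n -> P (n + 1)) -> forall n, P n.
Proof.
intros D H0 HS n.
destruct (@sigma1_induction (fun _ => P)) with (n := n) as (x & Hx); auto.
- exact (delta0_snd D).
- exists 0; assumption.
- intros m (x & Hx); exists x; auto.
Qed.

Lemma sigma2_induction (R : M -> M -> M -> Prop) :
  ISigma0 2 M ->
  delta0 (fun g : ctx M 3 => R (fst g) (fst (snd g)) (fst (snd (snd g)))) ->
  (exists x, forall y, R y x 0) ->
  (forall n, (exists x, forall y, R y x n) -> exists x, forall y, R y x (n + 1)) ->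
  forall n, exists x, forall y, R y x n.
Proof.
intros IS D H0 HS.
destruct (D model_set) as (phi & rho & sigma & B & H).
assert (E : forall n, sat (scons n rho) sigma (Ex (All phi)) <->
                      exists x, forall y, R y x n).
{ intros n; cbn; split; intros (x & Hx); exists x; intros y;
    apply (H (y, (x, (n, tt)))), Hx. }
intros n; apply E.
apply IS.
- repeat constructor; assumption.
- now apply E.
- intros m Hm; apply E, HS, E, Hm.
Qed.

Lemma delta1_comprehension (R S : M -> M -> Prop) :
  delta0 (fun g : ctx M 2 => R (fst g) (fst (snd g))) ->
  delta0 (fun g : ctx M 2 => S (fst g) (fst (snd g))) ->
  (forall n, (exists x, R x n) <-> (forall x, S x n)) ->
  exists A : pset M, forall n, n \in A <-> exists x, R x n.
Proof.
intros D D' E.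
destruct (delta0_merge D D' model_set)
  as (phi & psi & rho & sigma & B & B' & H & H').
assert (F : forall n, sat (scons n rho) sigma (Ex phi) <-> exists x, R x n).
{ intros n; cbn; split; intros (x & Hx); exists x; apply (H (x, (n, tt))), Hx. }
assert (F' : forall n, sat (scons n rho) sigma (All psi) <-> forall x, S x n).
{ intros n; cbn; split; intros Hx x; apply (H' (x, (n, tt))), Hx. }
destruct (@RCA0_comprehension M model_RCA0 (Ex phi) (All psi) rho sigma)
  as (A & HA).
- repeat constructor; assumption.
- repeat constructor; assumption.
- intros n; rewrite F, F'; apply E.
- exists A; intros n; rewrite HA; apply F.
Qed.

Lemma delta0_comprehension (P : M -> Prop) :
  delta0 (fun g : ctx M 1 => P (fst g)) ->
  exists A : pset M, forall n, n \in A <-> P n.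
Proof.
intros D.
destruct (@delta1_comprehension (fun _ => P) (fun _ => P)) as (A & HA).
- exact (delta0_snd D).
- exact (delta0_snd D).
- intros n; split; [now intros [_ Hn]|intros Hn; exists 0; apply Hn; exact 0].
- exists A; intros n; rewrite HA; split; [now intros [_ Hn]|now exists 0].
Qed.

(** * Ordered semiring arithmetic *)

Let basic := RCA0_basic model_RCA0.

Lemma addA (a b c : M) : a + (b + c) = (a + b) + c.
Proof.
revert c; apply delta0_induction; [definable| |].
- now rewrite !(add_zero basic).
- intros c IH; now rewrite !(add_succ basic), IH.
Qed.

Lemma add0l (a : M) : 0 + a = a.
Proof.
revert a; apply delta0_induction; [definable| |].
- apply (add_zero basic).
- intros c IH; now rewrite !(add_succ basic), IH.
Qed.

Lemma addSl (a b : M) : (a + 1) + b = (a + b) + 1.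
Proof.
revert b; apply delta0_induction; [definable| |].
- now rewrite !(add_zero basic).
- intros c IH; now rewrite !(add_succ basic), IH.
Qed.

Lemma addC (a b : M) : a + b = b + a.
Proof.
revert b; apply delta0_induction; [definable| |].
- now rewrite (add_zero basic), add0l.
- intros c IH; now rewrite addSl, (add_succ basic), IH.
Qed.

Lemma mul0l (a : M) : 0 * a = 0.
Proof.
revert a; apply delta0_induction; [definable| |].
- apply (mul_zero basic).
- intros c IH; now rewrite (mul_succ basic), IH, (add_zero basic).
Qed.

Lemma mulDl (a b c : M) : (a + b) * c = a * c + b * c.
Proof.
revert c; apply delta0_induction; [definable| |].
- now rewrite !(mul_zero basic), (add_zero basic).
- intros c IH; rewrite !(mul_succ basic), IH, !addA; f_equal.
  rewrite <- !addA; f_equal; apply addC.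
Qed.

Lemma mul1l (a : M) : 1 * a = a.
Proof.
revert a; apply delta0_induction; [definable| |].
- apply (mul_zero basic).
- intros c IH; now rewrite (mul_succ basic), IH.
Qed.

Lemma mulC (a b : M) : a * b = b * a.
Proof.
revert b; apply delta0_induction; [definable| |].
- now rewrite (mul_zero basic), mul0l.
- intros c IH; now rewrite (mul_succ basic), IH, mulDl, mul1l.
Qed.

Lemma mulA (a b c : M) : a * (b * c) = (a * b) * c.
Proof.
revert c; apply delta0_induction; [definable| |].
- now rewrite !(mul_zero basic).
- intros c IH.
  now rewrite !(mul_succ basic), (mulC a (b * c + b)), mulDl, <- IH,
    (mulC (b * c)), (mulC b a).
Qed.

Lemma semiring : semi_ring_theory (0 : M) 1 add mul eq.
Proof.
constructor; auto using add0l, addC, addA, mul1l, mul0l, mulC, mulA, mulDl.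
Qed.

Add Ring Mring : semiring.

Lemma lt_exists (x y : M) : x < y <-> exists d, y = x + d + 1.
Proof.
split.
- revert y.
  (* The hypothesis is placed under the existential quantifier to keep the induction formula
     Sigma^0_1; where it fails, any witness will do. The same device recurs in later inductions. *)
  assert (K : forall y, exists d, x < y -> y = x + d + 1).
  { apply sigma1_induction; [definable| |].
    - exists 0; intros E; now apply (lt_zero basic) in E.
    - intros y (d & IH).
      destruct (classic (x < y)) as [E|E].
      + exists (d + 1); intros _; rewrite (IH E) at 1; ring.
      + exists 0; intros [F| ->]%(lt_succ basic); [tauto|ring]. }
  intros y Hy; destruct (K y) as (d & Hd); exists d; auto.
- intros (d & ->); revert d; apply delta0_induction; [definable| |].
  + apply (lt_succ basic); right; ring.
  + intros d IH; apply (lt_succ basic); left.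
    replace (x + (d + 1)) with (x + d + 1) by ring; exact IH.
Qed.

Lemma add_cancel_r (x y z : M) : x + z = y + z -> x = y.
Proof.
revert z; apply (@delta0_induction (fun z => x + z = y + z -> x = y));
  [definable| |].
- now rewrite !(add_zero basic).
- intros z IH; rewrite !(add_succ basic); intros E%(succ_inj basic); auto.
Qed.

Lemma add_cancel_l (x y z : M) : z + x = z + y -> x = y.
Proof. rewrite !(addC z); apply add_cancel_r. Qed.

Lemma le_exists (x y : M) : x <= y <-> exists d, y = x + d.
Proof.
rewrite lt_exists; split; intros (d & E); exists d.
- now apply (succ_inj basic) in E.
- now rewrite E.
Qed.

Lemma le_lteq (x y : M) : x <= y <-> x < y \/ x = y.
Proof. apply (lt_succ basic). Qed.

Lemma lt_irrefl (x : M) : ~ x < x.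
Proof.
intros (d & E)%lt_exists; apply (succ_neq0 basic (n := d)).
apply (@add_cancel_l _ _ x); rewrite E at 2; ring.
Qed.

Lemma lt_trans (x y z : M) : x < y -> y < z -> x < z.
Proof.
intros (d & ->)%lt_exists (e & ->)%lt_exists; apply lt_exists.
exists (d + 1 + e); ring.
Qed.

Lemma lt_le (x y : M) : x < y -> x <= y.
Proof. intros H; apply le_lteq; auto. Qed.

Lemma le_refl (x : M) : x <= x.
Proof. apply le_lteq; auto. Qed.

Lemma lt_le_trans (x y z : M) : x < y -> y <= z -> x < z.
Proof. intros H [H'| <-]%le_lteq; eauto using lt_trans. Qed.

Lemma le_lt_trans (x y z : M) : x <= y -> y < z -> x < z.
Proof. intros [H'| ->]%le_lteq H; eauto using lt_trans. Qed.

Lemma le_trans (x y z : M) : x <= y -> y <= z -> x <= z.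
Proof. intros H [H'| <-]%le_lteq; eauto using lt_le_trans, lt_le, le_lt_trans. Qed.

Lemma not_lt0 (x : M) : ~ x < 0.
Proof. apply (lt_zero basic). Qed.

Lemma le0 (x : M) : 0 <= x.
Proof. apply le_exists; exists x; ring. Qed.

Lemma le_addr (x y : M) : x <= x + y.
Proof. apply le_exists; exists y; ring. Qed.

Lemma le_addl (x y : M) : x <= y + x.
Proof. apply le_exists; exists y; ring. Qed.

Lemma lt_total (x y : M) : x < y \/ x = y \/ y < x.
Proof.
revert y; apply delta0_induction; [definable| |].
- right; destruct (le_lteq 0 x) as [H _]; destruct (H (le0 x)); auto.
- intros y [H|[->|H]].
  + left; apply lt_le, H.
  + left; apply le_refl.
  + right; apply lt_exists in H as (d & ->).
    destruct (le_lteq (y + 1) (y + d + 1)) as [H _].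
    destruct H; auto; apply le_exists; exists d; ring.
Qed.

Lemma le_total (x y : M) : x <= y \/ y < x.
Proof. destruct (lt_total x y) as [H|[->|H]]; auto using lt_le, le_refl. Qed.

Lemma lt_mono_add (a b c d : M) : a < b -> c <= d -> a + c < b + d.
Proof.
intros (e & ->)%lt_exists (f & ->)%le_exists; apply lt_exists.
exists (e + f); ring.
Qed.

Lemma le_mono_mul (a b c d : M) : a <= b -> c <= d -> a * c <= b * d.
Proof.
intros (e & ->)%le_exists (f & ->)%le_exists; apply le_exists.
exists (e * c + a * f + e * f); ring.
Qed.

Lemma lt_succ_le (x y : M) : x < y -> x + 1 <= y.
Proof. intros (d & ->)%lt_exists; apply le_exists; exists d; ring. Qed.

Lemma lt_cancel_succ (x y : M) : x + 1 < y + 1 -> x < y.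
Proof.
intros (d & E)%lt_exists; apply lt_exists; exists d.
apply (succ_inj basic) in E; rewrite E; ring.
Qed.

Lemma zero_or_succ (x : M) : x = 0 \/ exists y, x = y + 1.
Proof.
destruct (lt_total x 0) as [H|[H|H]]; auto.
- now apply not_lt0 in H.
- right; apply lt_exists in H as (d & ->); exists d; ring.
Qed.

Lemma le_mul_self (x y : M) : x <= x * (y + 1).
Proof. apply le_exists; exists (x * y); ring. Qed.

(** * Pairing *)

Lemma le_pairl (i j : M) : i <= pair i j.
Proof. apply le_addl. Qed.

Lemma le_square (x : M) : x <= x * x.
Proof.
destruct (zero_or_succ x) as [->|(y & ->)].
- apply le_exists; exists 0; ring.
- apply le_mul_self.
Qed.

Lemma le_pairr (i j : M) : j <= pair i j.
Proof.
apply le_trans with (i + j); [apply le_addl|].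
apply le_trans with ((i + j) * (i + j)); [apply le_square|apply le_addr].
Qed.

(** The code of (i, j) lies from (i + j)^2 up to, but below, (i + j + 1)^2, so codes are ordered
    first by diagonals. *)
Lemma pair_lt_diag (i j i' j' : M) : i + j < i' + j' -> pair i j < pair i' j'.
Proof.
unfold pair; intros H%lt_succ_le.
apply lt_le_trans with ((i + j + 1) * (i + j + 1)).
- apply lt_exists; exists (i + j + j); ring.
- apply le_trans with ((i' + j') * (i' + j')); [|apply le_addr].
  apply le_mono_mul; exact H.
Qed.

Lemma pair_inj (i j i' j' : M) : pair i j = pair i' j' -> i = i' /\ j = j'.
Proof.
intros E.
assert (S : i + j = i' + j').
{ destruct (lt_total (i + j) (i' + j')) as [H|[H|H]]; auto;
    apply pair_lt_diag in H; rewrite E in H; now apply lt_irrefl in H. }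
assert (i = i') as <-.
{ unfold pair in E; rewrite S in E; now apply add_cancel_l in E. }
split; [reflexivity|]; now apply add_cancel_l in S.
Qed.

Lemma pair_lt (i j a b : M) : i < a -> j < b -> pair i j < pair a b.
Proof. intros H H'; apply pair_lt_diag, lt_mono_add; auto using lt_le. Qed.

(** * Least number principle and collection *)

Lemma least_element (A : pset M) (x : M) :
  x \in A -> exists y, y \in A /\ forall z, z < y -> ~ z \in A.
Proof.
intros Hx; apply NNPP; intros H.
assert (K : forall x, forall z, z < x -> ~ z \in A).
{ apply (@delta0_induction (fun x => forall z, z < x -> ~ z \in A));
    [definable| |].
  - intros z Hz; now apply not_lt0 in Hz.
  - intros y IH z [Hz| ->]%le_lteq; auto.
    intros Hy; apply H; exists y; auto. }
exact (K (x + 1) x (le_refl x) Hx).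
Qed.

(** The bound is built by Sigma^0_1 induction on initial segments of [n], enlarging it by one
    witness at a time. *)
Lemma sigma1_collection (A : pset M) (n : M) :
  (forall i, i < n -> exists w, pair i w \in A) ->
  exists b, forall i, i < n -> exists w, w < b /\ pair i w \in A.
Proof.
intros H.
assert (K : forall m, exists b, m <= n ->
              forall i, i < m -> exists w, w < b /\ pair i w \in A).
{ apply sigma1_induction.
  - definable.
  - exists 0; intros _ i Hi; now apply not_lt0 in Hi.
  - intros m (b & IH).
    destruct (classic (m < n)) as [E|E].
    + destruct (H m E) as (w & Hw).
      exists (b + w + 1); intros _ i [Hi| ->]%le_lteq.
      * destruct (IH (lt_le E) i Hi) as (v & Hv & Hv').
        exists v; split; auto.
        apply lt_le_trans with b; auto.
        apply le_exists; exists (w + 1); ring.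
      * exists w; split; auto; apply le_addl.
    + exists 0; intros F%lt_cancel_succ; tauto. }
destruct (K n) as (b & Hb); exists b; apply Hb, le_refl.
Qed.

(** Sigma^0_1 induction run downwards: a failure at [n] gives a failure at [n - j] for every [j] up
    to [n], and [j = n] contradicts the base case. *)
Lemma pi1_induction (A : pset M) :
  (forall x, pair 0 x \in A) ->
  (forall n, (forall x, pair n x \in A) -> forall x, pair (n + 1) x \in A) ->
  forall n x, pair n x \in A.
Proof.
intros H0 HS n x0; apply NNPP; intros Hn.
assert (K : forall j, exists x, j <= n ->
              exists i, i <= n /\ i + j = n /\ ~ pair i x \in A).
{ apply sigma1_induction.
  - definable.
  - exists x0; intros _; exists n; repeat split; auto using le_refl; ring.
  - intros j (x & IH).
    destruct (classic (j + 1 <= n)) as [E|E]; [|exists 0; tauto].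
    destruct IH as (i & Hi & Eij & Hx); [now apply lt_le, lt_cancel_succ|].
    destruct (zero_or_succ i) as [->|(i' & ->)].
    + rewrite <- Eij, add0l in E; now apply lt_irrefl in E.
    + assert (K : exists y, ~ pair i' y \in A).
      { apply not_all_ex_not; intros H; apply Hx, HS, H. }
      destruct K as (y & Hy); exists y; intros _; exists i'.
      repeat split; auto.
      * apply lt_le in Hi; now apply lt_cancel_succ in Hi.
      * rewrite <- Eij; ring. }
destruct (K n) as (x & i & _ & Ei & Hx); [apply le_refl|].
assert (i = 0) as -> by (apply (@add_cancel_r _ _ n); rewrite Ei; ring).
apply Hx, H0.
Qed.

(** * Finite sets *)

Lemma add_eq0 (a b : M) : a + b = 0 -> b = 0.
Proof.
intros E; destruct (zero_or_succ b) as [->|(c & ->)]; auto.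
rewrite (add_succ basic) in E; now apply (succ_neq0 basic) in E.
Qed.

Lemma divides_mulr (d a b : M) : divides d a -> divides d (a * b).
Proof. intros (q & ->); exists (q * b); ring. Qed.

Lemma divides_add_cancel (d a b : M) :
  divides d (a + b) -> divides d a -> divides d b.
Proof.
intros (p & E) (q & ->).
destruct (le_total q p) as [(r & ->)%le_exists|(r & ->)%lt_exists].
- exists r; apply (@add_cancel_l _ _ (d * q)); rewrite E; ring.
- exists 0; rewrite (mul_zero basic).
  apply (@add_eq0 (d * (r + 1))), (@add_cancel_l _ _ (d * p)).
  transitivity (d * (p + r + 1) + b); [ring|]; rewrite E; ring.
Qed.

(** Bounding the quotient makes divisibility Delta^0_0. For divisor 0 the quotient is arbitrary and
    is replaced by 0. *)
Lemma divides_le (d n : M) : divides d n <-> exists q, q <= n /\ n = d * q.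
Proof.
split; [|intros (q & _ & E); exists q; exact E].
intros (q & ->); destruct (zero_or_succ d) as [->|(e & ->)].
- exists 0; split; [apply le0|ring].
- exists q; split; [rewrite mulC; apply le_mul_self|reflexivity].
Qed.

Lemma delta0_divides k (f h : ctx M k -> M) :
  dterm f -> dterm h -> delta0 (fun g => divides (f g) (h g)).
Proof.
intros Hf Hh.
apply (@delta0_ext M k (fun g => exists q, q <= h g /\ h g = f g * q)).
- intros g; symmetry; apply divides_le.
- definable.
Qed.

#[local] Hint Resolve delta0_divides : definability.

(** The witness grows like a factorial; it serves as the multiplier [m] in the moduli
    [m * (i + 1) + 1] of the beta function. *)
Lemma common_multiple (k : M) :
  exists m, 0 < m /\ forall i, i <= k -> 0 < i -> divides i m.
Proof.
revert k; apply sigma1_induction; [definable| |].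
- exists 1; split; [apply lt_exists; exists 0; ring|].
  intros i [H| ->]%le_lteq H'; [now apply not_lt0 in H|now apply lt_irrefl in H'].
- intros k (m & Hm & IH); exists (m * (k + 1)); split.
  + apply lt_le_trans with m; auto using le_mul_self.
  + intros i [Hi| ->]%le_lteq Hi'.
    * now apply divides_mulr, IH.
    * exists m; ring.
Qed.

(* Coprimality of the moduli of the beta function, without Bezout: if
   d = m(i+1)+1 and |i-j| = e+1, then d divides n m (e+1), hence n (e+1), hence
   n m, and therefore n. *)
Lemma beta_coprime (k m n i j : M) :
  (forall e, e <= k -> 0 < e -> divides e m) -> i < k -> j < k -> i <> j ->
  divides (m * (i + 1) + 1) (n * (m * (j + 1) + 1)) ->
  divides (m * (i + 1) + 1) n.
Proof.
intros Hm Hi Hj Hij H.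
assert (K : exists e, divides (e + 1) m /\
                      divides (m * (i + 1) + 1) (n * (m * (e + 1)))).
{ destruct (lt_total i j) as [(e & ->)%lt_exists|[->|(e & ->)%lt_exists]].
  - exists e; split.
    + apply Hm; [|apply lt_exists; exists e; ring].
      apply lt_le, le_lt_trans with (i + e + 1); auto.
      apply le_exists; exists i; ring.
    + apply divides_add_cancel with (n * (m * (i + 1) + 1)).
      * replace (n * (m * (i + 1) + 1) + n * (m * (e + 1)))
          with (n * (m * (i + e + 1 + 1) + 1)) by ring; exact H.
      * exists n; ring.
  - tauto.
  - exists e; split.
    + apply Hm; [|apply lt_exists; exists e; ring].
      apply lt_le, le_lt_trans with (j + e + 1); auto.
      apply le_exists; exists j; ring.
    + apply divides_add_cancel with (n * (m * (j + 1) + 1)); [|exact H].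
      exists n; ring. }
destruct K as (e & (q & E) & K).
assert (K1 : divides (m * (i + 1) + 1) (n * (e + 1))).
{ apply divides_add_cancel with (n * (m * (e + 1)) * (i + 1)).
  - exists (n * (e + 1)); ring.
  - now apply divides_mulr. }
apply divides_add_cancel with (n * (e + 1) * (q * (i + 1))).
- exists n; rewrite E; ring.
- now apply divides_mulr.
Qed.

Lemma divides_succ_one (x : M) : divides (x + 1 + 1) 1 -> False.
Proof.
intros (q & E); destruct (zero_or_succ q) as [->|(p & ->)].
- apply (succ_neq0 basic (n := 0)); rewrite add0l, E; ring.
- apply (succ_neq0 basic (n := x + (x + 1 + 1) * p)).
  apply (@add_cancel_r _ _ 1); rewrite add0l.
  transitivity ((x + 1 + 1) * (p + 1)); [ring|symmetry; exact E].
Qed.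

Lemma fin_mem_pair (k m n i : M) :
  fin_mem (pair k (pair m n)) i <-> i < k /\ divides (m * (i + 1) + 1) n.
Proof.
split.
- intros (k' & m' & n' & [<- [<- <-]%pair_inj]%pair_inj & H); exact H.
- intros H; exists k, m, n; auto.
Qed.

Lemma fin_mem_lt (c i : M) : fin_mem c i -> i < c.
Proof.
intros (k & m & n & -> & H & _); apply lt_le_trans with k; auto using le_pairl.
Qed.

(** Components never exceed their code, so decoding needs only bounded quantifiers. *)
Lemma triple_le (c : M) (P : M -> M -> M -> Prop) :
  (exists k m n, c = pair k (pair m n) /\ P k m n) <->
  exists k, k <= c /\ exists m, m <= c /\ exists n, n <= c /\
    c = pair k (pair m n) /\ P k m n.
Proof.
split.
- intros (k & m & n & -> & H); exists k; split; [apply le_pairl|].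
  assert (K := le_pairr k (pair m n)).
  exists m; split; [eauto using le_trans, le_pairl|].
  exists n; split; [eauto using le_trans, le_pairr|auto].
- intros (k & _ & m & _ & n & _ & H); exists k, m, n; exact H.
Qed.

Lemma delta0_fin_mem k (f h : ctx M k -> M) :
  dterm f -> dterm h -> delta0 (fun g => fin_mem (f g) (h g)).
Proof.
intros Hf Hh.
apply (@delta0_ext M k (fun g =>
  exists k, k <= f g /\ exists m, m <= f g /\ exists n, n <= f g /\
    f g = pair k (pair m n) /\ (h g < k /\ divides (m * (h g + 1) + 1) n))).
- intros g; symmetry; apply triple_le.
- definable.
Qed.

Lemma delta0_triple k (f : ctx M k -> M) :
  dterm f -> delta0 (fun g => triple (f g)).
Proof.
intros Hf.
apply (@delta0_ext M k (fun g =>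
  exists k, k <= f g /\ exists m, m <= f g /\ exists n, n <= f g /\
    f g = pair k (pair m n) /\ 0 = (0 : M))).
- intros g; rewrite <- triple_le.
  split; intros (a & m & n & H); exists a, m, n; tauto.
- definable.
Qed.

#[local] Hint Resolve delta0_fin_mem delta0_triple : definability.

Lemma delta0_fin_code k (f : ctx M k -> M) :
  dterm f -> delta0 (fun g => fin_code (f g)).
Proof.
intros Hf.
apply (@delta0_ext M k (fun g => triple (f g) /\ forall d, d < f g -> triple d ->
  ~ forall i, i < f g -> (fin_mem d i <-> fin_mem (f g) i))).
- intros g; split; intros (H & H'); split; auto; intros d Hd Td E;
    apply (H' d Hd Td).
  + intros i _; apply E.
  + intros i; split; intros Hi; apply E; auto; apply fin_mem_lt in Hi;
      eauto using lt_trans.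
- definable.
Qed.

(** The code is the product of the moduli belonging to the elements of [A] below [k]. By
    [beta_coprime], a modulus divides this product only if it is one of the factors. *)
Lemma triple_comprehension (A : pset M) (k : M) :
  exists c, triple c /\ forall i, fin_mem c i <-> i < k /\ i \in A.
Proof.
destruct (common_multiple k) as (m & Hm0 & Hm).
assert (K : forall j, exists n, j <= k -> forall i, i < k ->
              (divides (m * (i + 1) + 1) n <-> i < j /\ i \in A)).
{ apply sigma1_induction; [definable| |].
  (* The empty product. Positivity of [m] makes every modulus at least 2, so none divides 1. *)
  - exists 1; intros _ i Hi; split.
    + intros H; exfalso; apply lt_exists in Hm0 as (m' & ->).
      apply (@divides_succ_one (m' + (m' + 1) * i)).
      replace (m' + (m' + 1) * i + 1 + 1) with ((0 + m' + 1) * (i + 1) + 1)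
        by ring; exact H.
    + intros (H & _); now apply not_lt0 in H.
  - intros j (n & IH).
    destruct (classic (j < k)) as [Hj|Hj];
      [|exists 0; intros F%lt_cancel_succ; tauto].
    specialize (IH (lt_le Hj)).
    destruct (classic (j \in A)) as [Aj|Aj].
    + exists (n * (m * (j + 1) + 1)); intros _ i Hi.
      destruct (classic (i = j)) as [->|Hij].
      * split; [intros _; split; auto using le_refl|].
        intros _; exists n; ring.
      * transitivity (divides (m * (i + 1) + 1) n).
        { split; [|apply divides_mulr].
          now apply beta_coprime with k. }
        rewrite IH, le_lteq; tauto.
    + exists n; intros _ i Hi; rewrite IH, le_lteq; auto.
      split; [tauto|]; intros [[H| ->] H']; tauto. }
destruct (K k) as (n & Hn); specialize (Hn (le_refl k)).
exists (pair k (pair m n)); split; [exists k, m, n; reflexivity|].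
intros i; rewrite fin_mem_pair; split; intros (Hi & H); split; auto.
- now apply Hn.
- apply Hn; auto.
Qed.

Lemma finite_comprehension (P : M -> Prop) (k : M) :
  delta0 (fun g : ctx M 1 => P (fst g)) ->
  exists c, fin_code c /\ forall i, fin_mem c i <-> i < k /\ P i.
Proof.
intros D; destruct (delta0_comprehension D) as (A & HA).
destruct (triple_comprehension A k) as (c & Tc & Hc).
(* [fin_code] asks for the least triple representing the set. The bound [c + d] exceeds all elements
   of both sets, so having the same elements is Delta^0_0 and a least such [d] exists. *)
destruct (@delta0_comprehension (fun d => triple d /\
  forall i, i <= c + d -> (fin_mem d i <-> fin_mem c i))) as (B & HB).
{ definable. }
destruct (@least_element B c) as (d & Hd & Hmin).
{ apply HB; split; auto; tauto. }
assert (E : forall d, d \in B <-> triple d /\ forall i, fin_mem d i <-> fin_mem c i).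
{ intros b; rewrite HB; split; intros (T & H); split; auto.
  intros i; split; intros Hi; apply H; auto; apply fin_mem_lt in Hi.
  - eauto using lt_le_trans, le_addl, lt_le, le_trans.
  - eauto using lt_le_trans, le_addr, lt_le, le_trans. }
apply E in Hd as (Td & Ed); exists d; split.
- split; auto; intros b Hb Tb Eb; apply (Hmin b Hb), E; split; auto.
  intros i; rewrite Eb; apply Ed.
- intros i; rewrite Ed, Hc, HA; tauto.
Qed.

(** * Finite sequences, finite relations and cardinality *)

Lemma fin_mem_pair_ltl (s i j : M) : fin_mem s (pair i j) -> i < s.
Proof. intros H%fin_mem_lt; eauto using le_lt_trans, le_pairl. Qed.

Lemma fin_mem_pair_ltr (s i j : M) : fin_mem s (pair i j) -> j < s.
Proof. intros H%fin_mem_lt; eauto using le_lt_trans, le_pairr. Qed.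

Lemma pair_le (z : M) (P : M -> M -> Prop) :
  (exists i j, z = pair i j /\ P i j) <->
  exists i, i <= z /\ exists j, j <= z /\ z = pair i j /\ P i j.
Proof.
split.
- intros (i & j & -> & H); exists i; split; [apply le_pairl|].
  exists j; split; [apply le_pairr|auto].
- intros (i & _ & j & _ & H); exists i, j; exact H.
Qed.

#[local] Hint Resolve delta0_fin_code : definability.

(** Members of a code lie below it, which bounds all quantifiers. The domain condition is split into
    its two directions because the length bounds [i] in one and the code bounds it in the other. *)
Lemma delta0_fin_seq k (f h : ctx M k -> M) :
  dterm f -> dterm h -> delta0 (fun g => fin_seq (f g) (h g)).
Proof.
intros Hf Hh.
apply (@delta0_ext M k (fun g => fin_code (f g) /\
  (forall z, z < f g -> fin_mem (f g) z ->
     exists i, i <= z /\ exists j, j <= z /\ z = pair i j) /\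
  (forall i, i < f g -> forall j, j < f g -> forall k, k < f g ->
     fin_mem (f g) (pair i j) -> fin_mem (f g) (pair i k) -> j = k) /\
  (forall i, i < h g -> exists j, j < f g /\ fin_mem (f g) (pair i j)) /\
  (forall i, i < f g -> forall j, j < f g ->
     fin_mem (f g) (pair i j) -> i < h g))).
- intros g; unfold fin_seq; split.
  + intros (H1 & H2 & H3 & H4 & H5).
    split; [exact H1|split; [|split; [|intros i; split]]].
    * intros z Hz; destruct (H2 z) as (i & _ & j & _ & E);
        eauto using fin_mem_lt.
    * intros i j l Hj Hl.
      apply (H3 i) with (5 := Hl) (4 := Hj);
        eauto using fin_mem_pair_ltl, fin_mem_pair_ltr.
    * intros Hi; destruct (H4 i Hi) as (j & _ & Hj); eauto.
    * intros (j & Hj); apply (H5 i) with (3 := Hj);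
        eauto using fin_mem_pair_ltl, fin_mem_pair_ltr.
  + intros (H1 & H2 & H3 & H4).
    split; [exact H1|split; [|split; [|split]]].
    * intros z _ Hz; destruct (H2 z Hz) as (i & j & ->).
      exists i; split; [apply le_pairl|]; exists j; auto using le_pairr.
    * eauto.
    * intros i Hi; apply H4 in Hi as (j & Hj); exists j; split; auto.
      eauto using fin_mem_pair_ltl, fin_mem_pair_ltr.
    * intros i _ j _ Hj; apply H4; eauto.
- definable.
Qed.

(** The context has length three because [P] is used under quantifiers over [i] and [x] inside a
    predicate of the coded pair [z]. *)
Lemma finite_relation (P : M -> M -> Prop) (l b : M) :
  delta0 (fun g : ctx M 3 => P (fst (snd g)) (fst g)) ->
  exists s, fin_code s /\
    (forall z, fin_mem s z -> exists i x, z = pair i x) /\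
    (forall i x, fin_mem s (pair i x) <-> i < l /\ x < b /\ P i x).
Proof.
intros D.
destruct (@finite_comprehension
  (fun z => exists i, i < l /\ exists x, x < b /\ z = pair i x /\ P i x)
  (pair l b)) as (s & Cs & Hs).
{ definable. }
exists s; split; [|split]; auto.
- intros z (_ & i & _ & x & _ & E & _)%Hs; eauto.
- intros i x; rewrite Hs; split.
  + intros (_ & i' & Hi & x' & Hx & [<- <-]%pair_inj & H); auto.
  + intros (Hi & Hx & H); split; [now apply pair_lt|]; eauto 8.
Qed.

Lemma fin_seq_exists (P : M -> M -> Prop) (l b : M) :
  delta0 (fun g : ctx M 3 => P (fst (snd g)) (fst g)) ->
  (forall i, i < l -> exists x, x < b /\ P i x) ->
  (forall i x y, i < l -> P i x -> P i y -> x = y) ->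
  exists s, fin_seq s l /\ forall i x, fin_mem s (pair i x) <-> i < l /\ P i x.
Proof.
intros D H1 H2; destruct (finite_relation l b D) as (s & Cs & Ps & Hs).
assert (K : forall i x, fin_mem s (pair i x) <-> i < l /\ P i x).
{ intros i x; rewrite Hs; split; [tauto|]; intros (Hi & Hx).
  destruct (H1 i Hi) as (y & Hy & Hiy).
  rewrite (H2 i x y Hi Hx Hiy); auto. }
exists s; split; auto.
split; [exact Cs|split; [|split; [|intros i; split]]].
- intros z (i & x & ->)%Ps; eauto.
- intros i j k (Hi & Hj)%K (_ & Hk)%K; eauto.
- intros Hi; destruct (H1 i Hi) as (j & Hj & Hij); exists j; apply K; auto.
- intros (j & Hj); now apply K in Hj.
Qed.

(** The matrix of [card] with its sequence exposed: this is Delta^0_0, whereas [card] is stated with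
    an unbounded quantifier. *)
Definition enumeration (c n s : M) : Prop :=
  fin_seq s n /\
  (forall i j k : M, fin_mem s (pair i k) -> fin_mem s (pair j k) -> i = j) /\
  (forall k : M, fin_mem c k <-> exists i : M, fin_mem s (pair i k)).

#[local] Hint Resolve delta0_fin_seq : definability.

Lemma delta0_enumeration k (f h t : ctx M k -> M) :
  dterm f -> dterm h -> dterm t ->
  delta0 (fun g => enumeration (f g) (h g) (t g)).
Proof.
intros Hf Hh Ht.
apply (@delta0_ext M k (fun g => fin_seq (t g) (h g) /\
  (forall i, i < t g -> forall j, j < t g -> forall k, k < t g ->
     fin_mem (t g) (pair i k) -> fin_mem (t g) (pair j k) -> i = j) /\
  (forall k, k < f g -> fin_mem (f g) k ->
     exists i, i < t g /\ fin_mem (t g) (pair i k)) /\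
  (forall i, i < t g -> forall k, k < t g ->
     fin_mem (t g) (pair i k) -> fin_mem (f g) k))).
- intros g; unfold enumeration; split.
  + intros (H1 & H2 & H3 & H4).
    split; [exact H1|split; [|intros y; split]].
    * intros i j l Hj Hl.
      apply (H2 i) with (5 := Hl) (4 := Hj);
        eauto using fin_mem_pair_ltl, fin_mem_pair_ltr.
    * intros Hk; destruct (H3 y) as (i & _ & Hi); eauto using fin_mem_lt.
    * intros (i & Hi); apply (H4 i) with (3 := Hi);
        eauto using fin_mem_pair_ltl, fin_mem_pair_ltr.
  + intros (H1 & H2 & H3); split; [exact H1|split; [|split]].
    * eauto.
    * intros l _ (i & Hi)%H3; exists i; split; auto.
      eauto using fin_mem_pair_ltl, fin_mem_pair_ltr.
    * intros i _ l _ Hi; apply H3; eauto.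
- definable.
Qed.

Lemma card_empty :
  exists c : M, fin_code c /\ (forall i, ~ fin_mem c i) /\ card c 0.
Proof.
destruct (@finite_comprehension (fun i => i = i) 0) as (c & Cc & Hc).
{ definable. }
assert (H : forall i, ~ fin_mem c i).
{ intros i Hi; apply Hc in Hi as (Hi & _); now apply not_lt0 in Hi. }
destruct (@fin_seq_exists (fun i x => i = x) 0 0) as (s & Fs & Hs).
- definable.
- intros i Hi; now apply not_lt0 in Hi.
- congruence.
- assert (H' : forall i x, ~ fin_mem s (pair i x)).
  { intros i x Hi; apply Hs in Hi as (Hi & _); now apply not_lt0 in Hi. }
  exists c; split; [exact Cc|split; [exact H|]].
  exists s; split; [exact Fs|split].
  + intros i j k Hi; now apply H' in Hi.
  + intros k; split; [intros Hk; now apply H in Hk|].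
    intros (i & Hi); now apply H' in Hi.
Qed.

Lemma card_add (c n x : M) :
  card c n -> ~ fin_mem c x ->
  exists d, fin_code d /\ (forall i, fin_mem d i <-> fin_mem c i \/ i = x) /\
    card d (n + 1).
Proof.
intros (s & (Cs & Ps & Us & Ds) & Is & Hs) Hx.
destruct (@finite_comprehension (fun i => fin_mem c i \/ i = x) (c + x + 1))
  as (d & Cd & Hd); [definable|].
assert (Ed : forall i, fin_mem d i <-> fin_mem c i \/ i = x).
{ intros i; rewrite Hd; split; [tauto|]; intros H; split; auto.
  destruct H as [H%fin_mem_lt| ->]; [|apply le_addl].
  apply lt_le, lt_le_trans with c; auto using le_addr. }
exists d; split; [exact Cd|split; [exact Ed|]].
assert (Hn : forall j, ~ fin_mem s (pair n j)).
{ intros j Hj; apply (@lt_irrefl n), Ds; eauto. }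
destruct (@fin_seq_exists
  (fun i y => fin_mem s (pair i y) \/ i = n /\ y = x) (n + 1) (s + x + 1))
  as (t & Ft & Ht).
- definable.
- intros i [(y & Hy)%Ds| ->]%le_lteq.
  + exists y; split; auto.
    apply lt_le_trans with s; [eauto using fin_mem_pair_ltl, fin_mem_pair_ltr|].
    apply le_exists; exists (x + 1); ring.
  + exists x; split; auto using le_addl.
- intros i y z _ [H|(-> & ->)] [H'|(E & ->)]; subst; eauto;
    exfalso; eapply Hn; eassumption.
- exists t; split; [|split]; auto.
  + intros i j y (_ & H)%Ht (_ & H')%Ht.
    destruct H as [H|(-> & ->)], H' as [H'|(-> & E)]; subst; eauto;
      exfalso; apply Hx, Hs; eauto.
  + intros y; rewrite Ed, Hs; split.
    * intros [(i & Hi)| ->]; [exists i|exists n]; apply Ht; split; auto.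
      -- apply lt_le, Ds; eauto.
      -- apply le_refl.
    * intros (i & Hi); apply Ht in Hi as (_ & [H|(_ & H)]); eauto.
Qed.

(** Restricted to the first [m + 1] positions, [F] has a finite code, so it suffices that no code
    sends [m + 1] positions injectively to [m] values. Quantified over all codes, this is Pi^0_1 and
    is proved by induction on [m]. *)
Lemma pigeonhole (F : pset M) (m n : M) :
  m < n ->
  (forall i, i < n -> exists j, j < m /\ pair i j \in F) ->
  (forall i i' j, i < n -> i' < n -> j < m ->
     pair i j \in F -> pair i' j \in F -> i = i') -> False.
Proof.
intros Hmn HF IF.
pose (injects (m f : M) :=
  (forall i, i <= m -> exists j, j < m /\ fin_mem f (pair i j)) /\
  (forall i, i <= m -> forall i', i' <= m -> forall j, j < m ->
     fin_mem f (pair i j) -> fin_mem f (pair i' j) -> i = i')).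
destruct (@delta0_comprehension (fun z => exists m, m <= z /\ exists f, f <= z /\
  z = pair m f /\ ~ injects m f)) as (A & HA).
{ unfold injects; definable. }
assert (EA : forall m f, pair m f \in A <-> ~ injects m f).
{ intros l f; rewrite HA, <- pair_le; split.
  - intros (l' & f' & [<- <-]%pair_inj & H); exact H.
  - eauto. }
assert (K : forall m f, pair m f \in A).
{ apply pi1_induction.
  - intros f; apply EA; intros (H & _).
    destruct (H 0) as (j & Hj & _); [apply le_refl|now apply not_lt0 in Hj].
  - intros l IH f; apply EA; intros (H1 & H2).
    destruct (H1 (l + 1)) as (a & Ha & Hla); [apply le_refl|].
    (* Position [l + 1] and value [l] are dropped; a position that had value [l] receives instead
       [a], the value set free by position [l + 1]. *)
    destruct (@finite_relation
      (fun i j => fin_mem f (pair i j) \/ fin_mem f (pair i l) /\ j = a) (l + 1) l)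
      as (f' & _ & _ & Hf'); [definable|].
    assert (Hne : forall i j, i <= l -> j <= l ->
                    fin_mem f (pair i j) -> fin_mem f (pair (l + 1) j) -> False).
    { intros i j Hi Hj Hij Hlj; apply (@lt_irrefl (l + 1)).
      rewrite <- (H2 i (lt_le Hi) (l + 1) (le_refl _) j Hj Hij Hlj) at 1; auto. }
    specialize (IH f'); apply EA in IH; apply IH; split.
    + intros i Hi; destruct (H1 i (lt_le Hi)) as (j & Hj & Hij).
      destruct (proj1 (le_lteq j l) Hj) as [Hj'| ->].
      * exists j; split; auto; apply Hf'; auto.
      * assert (a < l).
        { apply le_lteq in Ha as [Ha| ->]; auto.
          exfalso; exact (Hne i l Hi Hj Hij Hla). }
        exists a; split; auto; apply Hf'; auto.
    + intros i Hi i' Hi' j Hj (_ & _ & Hij)%Hf' (_ & _ & Hij')%Hf'.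
      destruct Hij as [Hij|(Hij & ->)], Hij' as [Hij'|(Hij' & E)].
      * eapply (H2 i (lt_le Hi) i' (lt_le Hi') j (lt_le Hj)); auto.
      * subst; exfalso; exact (Hne i a Hi (lt_le Hj) Hij Hla).
      * exfalso; exact (Hne i' a Hi' (lt_le Hj) Hij' Hla).
      * eapply (H2 i (lt_le Hi) i' (lt_le Hi') l (le_refl _)); auto. }
destruct (@finite_relation (fun i j => pair i j \in F) n m) as (f & _ & _ & Hf).
{ definable. }
apply (proj1 (EA m f) (K m f)); split.
- intros i Hi; assert (Hin : i < n) by (eapply le_lt_trans; eauto).
  destruct (HF i Hin) as (j & Hj & Hij); exists j; split; auto.
  apply Hf; auto.
- intros i Hi i' Hi' j Hj (Hin & _ & H)%Hf (Hin' & _ & H')%Hf; eauto.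
Qed.

(** * Paths *)

(** The matrix of [connected], which is Delta^0_0 in the code, the length and the end points. *)
Definition path (V E : pset M) (s l u v : M) : Prop :=
  fin_seq s (l + 1) /\
  fin_mem s (pair 0 u) /\ fin_mem s (pair l v) /\
  (forall i x : M, fin_mem s (pair i x) -> x \in V) /\
  (forall i x y : M, i < l ->
     fin_mem s (pair i x) -> fin_mem s (pair (i + 1) y) -> pair x y \in E).

Lemma delta0_path (V E : pset M) k (f h p q : ctx M k -> M) :
  dterm f -> dterm h -> dterm p -> dterm q ->
  delta0 (fun g => path V E (f g) (h g) (p g) (q g)).
Proof.
intros Hf Hh Hp Hq.
apply (@delta0_ext M k (fun g => fin_seq (f g) (h g + 1) /\
  fin_mem (f g) (pair 0 (p g)) /\ fin_mem (f g) (pair (h g) (q g)) /\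
  (forall i, i < f g -> forall x, x < f g -> fin_mem (f g) (pair i x) -> x \in V) /\
  (forall i, i < h g -> forall x, x < f g -> forall y, y < f g ->
     fin_mem (f g) (pair i x) -> fin_mem (f g) (pair (i + 1) y) ->
     pair x y \in E))).
- intros g; unfold path; split; intros (H1 & H2 & H3 & H4 & H5);
    repeat (split; [assumption|]); split; intros;
    eauto using fin_mem_pair_ltl, fin_mem_pair_ltr.
- definable.
Qed.

#[local] Hint Resolve delta0_enumeration delta0_path : definability.

Lemma connected_refl (V E : pset M) (u : M) : u \in V -> connected V E u u.
Proof.
intros Hu.
destruct (@fin_seq_exists (fun _ x => x = u) (0 + 1) (u + 1)) as (s & Fs & Hs).
- definable.
- intros i _; exists u; split; auto using le_refl.
- congruence.
- exists s, 0; split; [exact Fs|split; [|split; [|split]]].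
  + apply Hs; auto using le_refl.
  + apply Hs; auto using le_refl.
  + intros i x (_ & ->)%Hs; exact Hu.
  + intros i x y Hi; now apply not_lt0 in Hi.
Qed.

Lemma graph_edge_vertices (V E : pset M) (u v : M) :
  graph V E -> pair u v \in E -> u \in V /\ v \in V.
Proof.
intros G H; apply (graph_pairs G) in H as (a & b & Ha & Hb & E1).
apply pair_inj in E1 as [-> ->]; auto.
Qed.

Lemma connected_vertices (V E : pset M) (u v : M) :
  connected V E u v -> u \in V /\ v \in V.
Proof. intros (s & l & _ & Hu & Hv & HV & _); eauto. Qed.

Lemma connected_snoc (V E : pset M) (u v w : M) :
  graph V E -> connected V E u v -> pair v w \in E -> connected V E u w.
Proof.
intros G (s & l & (Cs & Ps & Us & Ds) & Hu & Hv & HV & HE) Hvw.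
assert (Hl : forall x, ~ fin_mem s (pair (l + 1) x)).
{ intros x Hx; apply (@lt_irrefl (l + 1)), Ds; eauto. }
destruct (@fin_seq_exists
  (fun i x => fin_mem s (pair i x) \/ i = l + 1 /\ x = w) (l + 1 + 1) (s + w + 1))
  as (t & Ft & Ht).
- definable.
- intros i [(x & Hx)%Ds| ->]%le_lteq.
  + exists x; split; auto.
    apply lt_le_trans with s; eauto using fin_mem_pair_ltr.
    apply le_exists; exists (w + 1); ring.
  + exists w; split; auto using le_addl.
- intros i x y _ [H|(-> & ->)] [H'|(E1 & ->)]; subst; eauto;
    exfalso; eapply Hl; eassumption.
- exists t, (l + 1); split; [exact Ft|split; [|split; [|split]]].
  + apply Ht; split; auto using le0.
  + apply Ht; split; auto using le_refl.
  + intros i x (_ & [H|(_ & ->)])%Ht; eauto.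
    now apply (graph_edge_vertices G Hvw).
  + intros i x y Hi (_ & H)%Ht (_ & H')%Ht.
    destruct H as [H|(-> & _)]; [|now apply lt_irrefl in Hi].
    destruct H' as [H'|(E1%add_cancel_r & ->)].
    * apply (HE i); auto; apply lt_cancel_succ, Ds; eauto.
    * subst; now rewrite (Us _ _ _ H Hv).
Qed.

(** Sigma^0_1 induction on the position along the path. The vertex at a position is bounded by the
    code [s], so quantifying over it adds no complexity. *)
Lemma connected_induction (V E : pset M) (R : M -> M -> Prop) (u v : M) :
  delta0 (fun g : ctx M 3 => R (fst (snd g)) (fst g)) ->
  connected V E u v -> (exists w, R w u) ->
  (forall x y, pair x y \in E -> (exists w, R w x) -> exists w, R w y) ->
  exists w, R w v.
Proof.
intros D (s & l & (Cs & Ps & Us & Ds) & Hu & Hv & HV & HE) (w0 & H0) HS.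
assert (K : forall i, exists w, i <= l ->
              exists x, x < s /\ fin_mem s (pair i x) /\ R w x).
{ apply sigma1_induction.
  - definable.
  - exists w0; intros _; exists u; split; eauto using fin_mem_pair_ltr.
  - intros i (w & IH).
    destruct (classic (i < l)) as [Hi|Hi];
      [|exists 0; intros F%lt_cancel_succ; tauto].
    destruct IH as (x & _ & Hx & Rx); [now apply lt_le|].
    destruct (proj1 (Ds (i + 1))) as (y & Hy); [now apply lt_mono_add, le_refl|].
    destruct (HS x y) as (w' & Hw'); eauto.
    exists w'; intros _; exists y; split; eauto using fin_mem_pair_ltr. }
destruct (K l) as (w & x & _ & Hx & Rx); [apply le_refl|].
exists w; now rewrite (Us _ _ _ Hv Hx).
Qed.

Lemma connected_set (V E A : pset M) (u v : M) :
  connected V E u v -> u \in A ->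
  (forall x y, pair x y \in E -> x \in A -> y \in A) -> v \in A.
Proof.
intros C Hu HS.
destruct (@connected_induction V E (fun _ x => x \in A) u v) as (_ & Hv); auto.
- definable.
- exists 0; auto.
- intros x y Hxy (w & Hx); exists w; eauto.
Qed.

(** One number bounds both code and length, giving the single leading existential quantifier that
    the induction lemmas expect. *)
Lemma connected_bounded (V E : pset M) (u v : M) :
  connected V E u v <->
  exists w, exists s, s <= w /\ exists l, l <= w /\ path V E s l u v.
Proof.
split.
- intros (s & l & H); exists (s + l), s; split; [apply le_addr|].
  exists l; split; [apply le_addl|exact H].
- intros (w & s & _ & l & _ & H); exists s, l; exact H.
Qed.

(** Codes are not concatenated: connectedness to [u] is carried along the second path edge by edge.
    Symmetry below is obtained likewise, without reversing a code. *)
Lemma connected_trans (V E : pset M) (u v w : M) :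
  graph V E -> connected V E u v -> connected V E v w -> connected V E u w.
Proof.
intros G Huv Hvw; apply connected_bounded.
apply (@connected_induction V E (fun b x =>
  exists s, s <= b /\ exists l, l <= b /\ path V E s l u x) v w); auto.
- definable.
- now apply connected_bounded.
- intros x y Hxy Hx; apply connected_bounded.
  apply connected_bounded in Hx; eauto using connected_snoc.
Qed.

Lemma connected_edge (V E : pset M) (u v : M) :
  graph V E -> pair u v \in E -> connected V E u v.
Proof.
intros G H; apply connected_snoc with u; auto.
now apply connected_refl, (graph_edge_vertices G H).
Qed.

Lemma connected_sym (V E : pset M) (u v : M) :
  graph V E -> connected V E u v -> connected V E v u.
Proof.
intros G Huv; apply connected_bounded.
apply (@connected_induction V E (fun b x =>
  exists s, s <= b /\ exists l, l <= b /\ path V E s l x u) u v); auto.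
- definable.
- now apply connected_bounded, connected_refl, (connected_vertices Huv).
- intros x y Hxy Hx; apply connected_bounded.
  apply connected_bounded in Hx.
  apply connected_trans with x; auto.
  apply connected_edge; auto; now apply (graph_sym G).
Qed.

(** * From [ISigma0 2] to bases *)

Lemma bases_of_sigma2_induction :
  ISigma0 2 M -> finite_rank_ematroids_have_bases M.
Proof.
intros IS n E e Hm Hr.
(* Here [x] codes a set [X] with an enumeration of its [j] elements, and [y] bounds the search for
   an index of [X] in [e]. With [exists x, forall y] in front, this says that some [j]-element set
   lies outside the range of [e]. *)
pose (R y x j := exists X, X <= x /\ exists s, s <= x /\ x = pair X s /\
  fin_code X /\ (forall i, i < X -> fin_mem X i -> i \in E) /\ enumeration X j s /\
  forall k, k <= y -> forall c, c <= y -> pair k c \in e ->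
    ~ forall i, i < c + X -> (fin_mem c i <-> fin_mem X i)).
assert (ER : forall j, (exists x, forall y, R y x j) <->
  exists X, fin_sub X (fun i => i \in E) /\ card X j /\ ~ in_range e (fin_mem X)).
{ intros j; split.
  - intros (x & Hx).
    destruct (Hx 0) as (X & _ & s & _ & -> & CX & SX & Hs & _).
    exists X; split; [|split].
    + split; eauto using fin_mem_lt.
    + exists s; exact Hs.
    + intros (k & c & Hkc & Ec).
      destruct (Hx (k + c)) as (X' & _ & s' & _ & [<- <-]%pair_inj & _ & _ & _ & N).
      apply (N k (le_addr _ _) c (le_addl _ _) Hkc); intros i _; apply Ec.
  - intros (X & (CX & SX) & (s & Hs) & NX).
    exists (pair X s); intros y; exists X; split; [apply le_pairl|].
    exists s; split; [apply le_pairr|].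
    repeat (split; [auto|]); intros k _ c _ Hk H; apply NX; exists k, c; split; auto.
    intros i; split; intros Hi; apply H; auto; apply fin_mem_lt in Hi;
      eauto using lt_le_trans, le_addr, le_addl. }
assert (K : exists j, (exists x, forall y, R y x j) /\
                      ~ exists x, forall y, R y x (j + 1)).
{ apply NNPP; intros N.
  assert (Hn : forall k, exists x, forall y, R y x k).
  { apply sigma2_induction; auto.
    - unfold R; definable.
    - apply ER; destruct card_empty as (X & CX & HX & X0).
      exists X; split; [split; auto; intros i Hi; now apply HX in Hi|split; auto].
      intros (k & c & Hkc & Ec).
      destruct (ematroid_nonempty Hm Hkc) as (i & Hi); now apply Ec, HX in Hi.
    - intros j Hj; apply NNPP; intros Hj'; apply N; eauto. }
  destruct (proj1 (ER n) (Hn n)) as (X & SX & CX & NX); auto. }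
destruct K as (j & (X & (CX & SX) & HX & NX)%ER & Nj).
destruct (@delta0_comprehension (fun i => fin_mem X i)) as (B & HB); [definable|].
exists B; split; [|split].
- intros i Hi; apply SX, HB, Hi.
- intros k c Hkc Hc; apply NX, (ematroid_upward Hm Hkc); [split; auto|].
  intros i Hi; apply HB, Hc, Hi.
- intros x Hx Bx.
  destruct (@card_add X j x) as (Y & CY & EY & HY); auto.
  { intros H; apply Bx, HB, H. }
  (* [Y] has [j + 1] elements, hence is a value of [e]; its index is the witness that [B] spans
     [x]. *)
  assert (in_range e (fin_mem Y)) as (k & c & Hkc & Hc).
  { apply NNPP; intros NY; apply Nj, ER; exists Y; repeat split; auto.
    - apply CY.
    - apply CY.
    - intros i [Hi| ->]%EY; auto. }
  exists k, c; split; auto; intros i Hi; rewrite HB; apply EY, Hc, Hi.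
Qed.

(** * From bases to decompositions *)

(** Stated for predicates so as to cover finite codes, sets and, with [True], the existence of any
    nontrivial connection in the graph. *)
Definition dependent (V E : pset M) (P : M -> Prop) : Prop :=
  exists u v, P u /\ P v /\ u <> v /\ connected V E u v.

(** Dependence is Sigma^0_1, while [e] has to be a total function that exists as a set. So an index
    contains a set [c] and must be large enough to bound a path proving [c] dependent; all other
    indices receive a fixed dependent set. *)
Lemma dependent_enumeration (V E : pset M) :
  dependent V E (fun _ => True) ->
  exists e, is_fun e (fun _ => True) (fun c => fin_sub c (fun i => i \in V)) /\
    (forall k c, pair k c \in e -> dependent V E (fin_mem c)) /\
    (forall X, fin_sub X (fun i => i \in V) -> dependent V E (fin_mem X) ->
       exists k, pair k X \in e).
Proof.
intros (u0 & v0 & _ & _ & N0 & C0).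
(* The default value of [e]. *)
destruct (@finite_comprehension (fun i => i = u0 \/ i = v0) (u0 + v0 + 1))
  as (X0 & CX0 & HX0); [definable|].
assert (E0 : forall i, fin_mem X0 i <-> i = u0 \/ i = v0).
{ intros i; rewrite HX0; split; [tauto|]; intros H; split; auto.
  destruct H as [-> | ->]; [apply le_addr|apply le_addl]. }
assert (SX0 : fin_sub X0 (fun i => i \in V)).
{ split; auto; intros i [-> | ->]%E0; apply (connected_vertices C0). }
assert (DX0 : dependent V E (fin_mem X0)).
{ exists u0, v0; rewrite !E0; auto. }
(* [k] is a certificate for [c]: its first component is [c], and the second is only padding that
   makes [k] exceed the end points, code and length of a path inside the graph between two members
   of [c]. *)
pose (W k c := exists p, p <= k /\ k = pair c p /\ fin_code c /\
  (forall i, i < c -> fin_mem c i -> i \in V) /\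
  exists u, u <= k /\ exists v, v <= k /\ exists s, s <= k /\ exists l, l <= k /\
    fin_mem c u /\ fin_mem c v /\ u <> v /\ path V E s l u v).
assert (WS : forall k c, W k c -> fin_sub c (fun i => i \in V)).
{ intros k c (p & _ & _ & Cc & Sc & _); split; eauto using fin_mem_lt. }
assert (WD : forall k c, W k c -> dependent V E (fin_mem c)).
{ intros k c (p & _ & _ & _ & _ & u & _ & v & _ & s & _ & l & _ & Hu & Hv & N & P).
  exists u, v; repeat (split; [assumption|]); exists s, l; exact P. }
assert (WU : forall k c d, W k c -> W k d -> c = d).
{ intros k c d (p & _ & -> & _) (q & _ & E1 & _); now apply pair_inj in E1. }
assert (WL : forall k c, W k c -> c <= k).
{ intros k c (p & _ & -> & _); apply le_pairl. }
assert (WE : forall X, fin_sub X (fun i => i \in V) -> dependent V E (fin_mem X) ->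
               exists k, W k X).
{ intros X (CX & SX) (u & v & Hu & Hv & N & s & l & P).
  pose (p := u + v + (s + l)).
  assert (Hp := le_pairr X p).
  exists (pair X p), p; split; [exact Hp|].
  repeat (split; [auto|]).
  exists u; split; [eapply le_trans; [|exact Hp]; apply le_exists;
    exists (v + (s + l)); unfold p; ring|].
  exists v; split; [eapply le_trans; [|exact Hp]; apply le_exists;
    exists (u + (s + l)); unfold p; ring|].
  exists s; split; [eapply le_trans; [|exact Hp]; apply le_exists;
    exists (u + v + l); unfold p; ring|].
  exists l; split; [eapply le_trans; [|exact Hp]; apply le_exists;
    exists (u + v + s); unfold p; ring|auto]. }
destruct (@delta0_comprehension (fun z => exists k, k <= z /\ exists c, c <= z /\
  z = pair k c /\ (W k c \/ ~ (exists d, d <= k /\ W k d) /\ c = X0)))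
  as (e & He); [unfold W; definable|].
assert (Ee : forall k c, pair k c \in e <->
               W k c \/ ~ (exists d, d <= k /\ W k d) /\ c = X0).
{ intros k c; rewrite He, <- pair_le; split.
  - intros (k' & c' & [<- <-]%pair_inj & H); exact H.
  - eauto. }
exists e; repeat split.
- intros z Hz; assert (H := proj1 (He z) Hz).
  destruct H as (k & _ & c & _ & -> & [H|(_ & ->)]); exists k; eauto.
- intros k _; destruct (classic (exists c, W k c)) as [(c & Hc)|N].
  + exists c; split; [apply Ee; auto|].
    intros d [Hd|(F & _)]%Ee; [eauto|exfalso; apply F; eauto].
  + exists X0; split.
    * apply Ee; right; split; auto; intros (d & _ & Hd); eauto.
    * intros d [Hd|(_ & ->)]%Ee; auto; exfalso; eauto.
- intros k c [Hc|(_ & ->)]%Ee; eauto.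
- intros X SX DX; destruct (WE X SX DX) as (k & Hk); exists k; apply Ee; auto.
Qed.

(** Otherwise each element of [Y] is connected to one of [X]. Since [X] is smaller, two elements of
    [Y] would share a partner and so be connected to each other. *)
Lemma disconnected_exchange (V E : pset M) (X Y : M) :
  graph V E -> card_lt X Y -> ~ dependent V E (fin_mem Y) ->
  exists y, fin_mem Y y /\ forall x, fin_mem X x -> ~ connected V E y x.
Proof.
intros G (m & n & (sX & (CX & _ & UX & DX) & _ & HX) &
  (sY & (CY & _ & UY & DY) & IY & HY) & Hmn) NY.
apply NNPP; intros N.
assert (C : forall y, fin_mem Y y -> exists x, fin_mem X x /\ connected V E y x).
{ intros y Hy; apply NNPP; intros N'; apply N; exists y; split; auto.
  intros x Hx Hyx; eauto. }
clear N.
(* [w] bounds everything needed to connect the element of [Y] at position [a] with one of [X];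
   collection then gives one bound [b] for all positions. *)
destruct (@delta0_comprehension (fun z => exists a, a <= z /\ exists w, w <= z /\
  z = pair a w /\ exists i, i <= w /\ exists x, x <= w /\ exists y, y <= w /\
    exists s, s <= w /\ exists l, l <= w /\
    fin_mem sY (pair a y) /\ fin_mem sX (pair i x) /\ path V E s l y x))
  as (A & HA); [definable|].
destruct (@sigma1_collection A n) as (b & Hb).
{ intros a (y & Hay)%DY.
  destruct (C y) as (x & Hx & s & l & P); [apply HY; eauto|].
  apply HX in Hx as (i & Hix).
  exists (i + x + y + s + l); apply HA, pair_le.
  exists a, (i + x + y + s + l); split; [reflexivity|].
  exists i; split; [apply le_exists; exists (x + y + s + l); ring|].
  exists x; split; [apply le_exists; exists (i + y + s + l); ring|].
  exists y; split; [apply le_exists; exists (i + x + s + l); ring|].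
  exists s; split; [apply le_exists; exists (i + x + y + l); ring|].
  exists l; split; [apply le_exists; exists (i + x + y + s); ring|auto]. }
(* With paths searched only below [b], the relation from positions of [Y] to positions of [X] is
   Delta^0_0, hence a set to which the pigeonhole principle applies. *)
destruct (@delta0_comprehension (fun z => exists a, a <= z /\ exists i, i <= z /\
  z = pair a i /\ exists x, x < b /\ exists y, y < b /\
    exists s, s < b /\ exists l, l < b /\
    fin_mem sY (pair a y) /\ fin_mem sX (pair i x) /\ path V E s l y x))
  as (F & HF); [definable|].
assert (EF : forall a i, pair a i \in F -> exists x y,
    fin_mem sY (pair a y) /\ fin_mem sX (pair i x) /\ connected V E y x).
{ intros a i (a' & _ & i' & _ & [<- <-]%pair_inj &
    x & _ & y & _ & s & _ & l & _ & Ha & Hi & P)%HF.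
  exists x, y; repeat (split; [assumption|]); exists s, l; exact P. }
apply (@pigeonhole F m n Hmn).
- intros a Ha; destruct (Hb a Ha) as (w & Hw & Aw).
  apply HA, pair_le in Aw.
  destruct Aw as (a' & w' & [<- <-]%pair_inj &
    i & Hi & x & Hx & y & Hy & s & Hs & l & Hl & Hay & Hix & P).
  exists i; split; [apply DX; eauto|].
  apply HF, pair_le; exists a, i; split; [reflexivity|].
  exists x; split; [eapply le_lt_trans; eassumption|].
  exists y; split; [eapply le_lt_trans; eassumption|].
  exists s; split; [eapply le_lt_trans; eassumption|].
  exists l; split; [eapply le_lt_trans; eassumption|auto].
- intros a a' i _ _ _ (x & y & Hay & Hix & C1)%EF (x' & y' & Hay' & Hix' & C2)%EF.
  rewrite <- (UX _ _ _ Hix Hix') in C2.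
  destruct (classic (y = y')) as [->|Ny]; [eapply IY; eassumption|].
  exfalso; apply NY; exists y, y'; repeat split; auto.
  + apply HY; eauto.
  + apply HY; eauto.
  + apply connected_trans with x; auto; now apply connected_sym.
Qed.

Lemma dependent_add (V E : pset M) (P : M -> Prop) (y : M) :
  graph V E -> ~ dependent V E P -> dependent V E (fun i => P i \/ i = y) ->
  exists x, P x /\ connected V E y x.
Proof.
intros G N (u & v & [Hu| ->] & [Hv| ->] & Nuv & C).
- exfalso; apply N; exists u, v; auto.
- exists u; split; auto; now apply connected_sym.
- eauto.
- tauto.
Qed.

Lemma dependent_ext (V E : pset M) (P Q : M -> Prop) :
  (forall i, P i -> Q i) -> dependent V E P -> dependent V E Q.
Proof. intros H (u & v & Hu & Hv & C); exists u, v; auto. Qed.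

(** The case with no dependent set to enumerate: components are single vertices, so the identity on
    [V] decomposes the graph. *)
Lemma trivial_decomposition (V E : pset M) :
  ~ dependent V E (fun _ => True) -> exists h, decomposition V E h.
Proof.
intros N.
destruct (@delta0_comprehension (fun z => exists v, v <= z /\ exists w, w <= z /\
  z = pair v w /\ v \in V /\ v = w)) as (h & Hh); [definable|].
assert (Eh : forall v w, pair v w \in h <-> v \in V /\ v = w).
{ intros v w; rewrite Hh, <- pair_le; split.
  - intros (v' & w' & [<- <-]%pair_inj & H); exact H.
  - eauto. }
exists h; repeat split.
- intros z (v & _ & w & _ & H)%Hh; exists v, w; tauto.
- intros v Hv; exists v; split; [apply Eh; auto|].
  intros w (_ & ->)%Eh; reflexivity.
- intros ->; apply Eh in H1 as (_ & ->); apply Eh in H2 as (_ & ->).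
  now apply connected_refl.
- intros C; apply Eh in H1 as (_ & <-); apply Eh in H2 as (_ & <-).
  apply NNPP; intros Nuv; apply N; exists u, v; auto.
Qed.

(** That [b] represents [v] is Sigma^0_1 through a path from [v] to [b], and Pi^0_1 by saying that
    every element of [B] with a path from [v] equals [b]. The two agree because [B] meets each
    component exactly once. *)
Lemma decomposition_of_transversal (V E B : pset M) :
  graph V E -> subset B V ->
  (forall b b', b \in B -> b' \in B -> connected V E b b' -> b = b') ->
  (forall v, v \in V -> exists b, b \in B /\ connected V E v b) ->
  exists h, decomposition V E h.
Proof.
intros G SB UB CB.
destruct (@delta1_comprehension
  (fun x z => exists v, v <= z /\ exists b, b <= z /\ z = pair v b /\ b \in B /\
     exists s, s <= x /\ exists l, l <= x /\ path V E s l v b)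
  (fun x z => exists v, v <= z /\ exists b, b <= z /\ z = pair v b /\
     v \in V /\ b \in B /\
     forall c, c <= x -> forall s, s <= x -> forall l, l <= x ->
       c \in B -> path V E s l v c -> b = c))
  as (h & Hh); [definable|definable| |].
{ intros z; split.
  - intros (x & v & Hv & b & Hb & -> & Bb & s & _ & l & _ & P) y.
    assert (C : connected V E v b) by (exists s, l; exact P).
    exists v; split; auto; exists b; split; auto; repeat split; auto.
    + apply (connected_vertices C).
    + intros c _ s' _ l' _ Bc P'; apply UB; auto.
      apply connected_trans with v; auto; [now apply connected_sym|].
      exists s', l'; exact P'.
  - intros H.
    destruct (H 0) as (v & _ & b & _ & -> & Vv & Bb & _).
    destruct (CB v Vv) as (c & Bc & s & l & P).
    destruct (H (c + s + l)) as (v' & _ & b' & _ & [<- <-]%pair_inj & _ & _ & K).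
    assert (b = c) as <-.
    { apply (K c) with (s := s) (l := l); auto; apply le_exists.
      - exists (s + l); ring.
      - exists (c + l); ring.
      - exists (c + s); ring. }
    exists (s + l), v; split; [apply le_pairl|].
    exists b; split; [apply le_pairr|].
    repeat (split; [auto|]); exists s; split; [apply le_addr|].
    exists l; split; [apply le_addl|exact P]. }
assert (Eh : forall v b, pair v b \in h <-> b \in B /\ connected V E v b).
{ intros v b; rewrite Hh; split.
  - intros (x & v' & _ & b' & _ & [<- <-]%pair_inj & Bb & s & _ & l & _ & P).
    split; auto; exists s, l; exact P.
  - intros (Bb & (x & C)%connected_bounded); exists x; apply pair_le; eauto. }
exists h; repeat split.
- intros z Hz; assert (H := proj1 (Hh z) Hz).
  destruct H as (x & v & _ & b & _ & -> & _); exists v, b.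
  repeat split; auto; apply Eh in Hz as (_ & C); apply (connected_vertices C).
- intros v Hv; destruct (CB v Hv) as (b & Bb & C).
  exists b; split; [apply Eh; auto|].
  intros c (Bc & C')%Eh; apply UB; auto.
  apply connected_trans with v; auto; now apply connected_sym.
- intros <-; apply Eh in H1 as (_ & C); apply Eh in H2 as (_ & C').
  apply connected_trans with a; auto; now apply connected_sym.
- intros C; apply Eh in H1 as (Ba & C1); apply Eh in H2 as (Bb & C2).
  apply UB; auto; apply connected_trans with v; auto.
  apply connected_trans with u; auto; now apply connected_sym.
Qed.

Lemma decompositions_of_bases :
  finite_rank_ematroids_have_bases M -> finite_component_graphs_decompose M.
Proof.
intros HB n V E G Hn.
destruct (classic (dependent V E (fun _ => True))) as [D|N];
  [|now apply trivial_decomposition].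
destruct (dependent_enumeration D) as (e & Fe & De & Ee).
assert (RD : forall P, in_range e P -> dependent V E P).
{ intros P (k & c & Hkc & EP); apply De in Hkc.
  apply dependent_ext with (2 := Hkc); apply EP. }
assert (DR : forall X, fin_sub X (fun i => i \in V) ->
               dependent V E (fin_mem X) -> in_range e (fin_mem X)).
{ intros X SX DX; destruct (Ee X SX DX) as (k & Hk); exists k, X; split; tauto. }
destruct (HB n V e) as (B & SB & IB & CB).
- constructor; auto.
  + intros k c Hkc; destruct (De k c Hkc) as (u & v & Hu & _); eauto.
  + intros k c Y Hkc SY HY; apply DR; auto.
    apply dependent_ext with (2 := De k c Hkc); auto.
  + intros X Y SX SY HXY NX NY.
    destruct (@disconnected_exchange V E X Y) as (y & Hy & Cy); auto.
    exists y; split; auto; intros (x & Hx & Cx)%RD%dependent_add; auto.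
    now apply (Cy x).
- intros X SX HX; apply DR; auto.
  destruct (Hn X SX HX) as (u & v & H); exists u, v; exact H.
(* Independence speaks of finite sets only, but a dependence in [B] already shows in two of its
   elements, and this pair is a value of [e]. *)
- assert (IB' : ~ dependent V E (fun i => i \in B)).
  { intros (u & v & Hu & Hv & Nuv & C).
    destruct (@finite_comprehension (fun i => i = u \/ i = v) (u + v + 1))
      as (X & CX & HX); [definable|].
    assert (SX : fin_sub X (fun i => i \in V)).
    { split; auto; intros i (_ & [-> | ->])%HX; auto. }
    destruct (Ee X SX) as (k & Hk).
    - exists u, v; rewrite !HX; repeat split; auto using le_addr, le_addl.
    - apply (IB k X Hk); intros i (_ & [-> | ->])%HX; auto. }
  apply decomposition_of_transversal with B; auto.
  + intros b b' Bb Bb' C; apply NNPP; intros Nb; apply IB'; exists b, b'; auto.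
  + intros v Hv; destruct (classic (v \in B)) as [Bv|Nv].
    * exists v; split; auto using connected_refl.
    * destruct (CB v Hv Nv) as (k & c & Hkc & Hc).
      apply (@dependent_add V E (fun i => i \in B)); auto.
      apply dependent_ext with (2 := De k c Hkc); exact Hc.
Qed.

(** * From decompositions to [ISigma0 2] *)

(** Replaces the matrix of a Sigma^0_2 formula by a set of coded triples, so that the graph
    construction need not mention formulas. *)
Lemma bounded_formula_set (theta : formula) (rho : nat -> M) (sigma : nat -> pset M) :
  bounded theta -> exists T, forall i x y, pair i (pair x y) \in T <->
    sat (scons y (scons x (scons i rho))) sigma theta.
Proof.
intros B.
assert (D : delta0 (fun g : ctx M 5 =>
  sat (scons (fst g) (scons (fst (snd g)) (scons (fst (snd (snd (snd g)))) rho)))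
    sigma theta)).
{ intros _.
  (* The context below is [y, x, w, i, z]: variable [i] of [theta] has to skip [w], and the
     parameters skip [z] as well. *)
  exists (renf (lift 2 (fun i => match i with O => S O | S j => S (S (S j)) end))
            (fun i => i) theta), rho, sigma.
  split; [now apply bounded_renf|].
  intros g; apply sat_renf; auto.
  intros [|[|[|i]]]; reflexivity. }
destruct (@delta0_comprehension (fun z => exists i, i <= z /\ exists w, w <= z /\
  z = pair i w /\ exists x, x <= w /\ exists y, y <= w /\ w = pair x y /\
  sat (scons y (scons x (scons i rho))) sigma theta)) as (T & HT); [definable|].
exists T; intros i x y; rewrite HT, <- pair_le; split.
- intros (i' & w & [<- <-]%pair_inj & x' & _ & y' & _ & [<- <-]%pair_inj & H).
  exact H.
- intros H; exists i, (pair x y); split; [reflexivity|].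
  apply pair_le; eauto.
Qed.

(** * The graph of claims and refuting tokens *)

Section RefutationGraph.
Variables (T : pset M) (N : M).

Definition refuted_below (i x y : M) : Prop :=
  forall x', x' < x -> exists y', y' < y /\ ~ pair i (pair x' y') \in T.

Definition claim (u i x y : M) : Prop :=
  u = pair 0 (pair i (pair x y)) /\ i <= N /\ refuted_below i x y.

(** Tag 1, against tag 0 for claims. Nothing is asked of [w]; whether a token carries a
    counterexample matters only in [refutes]. *)
Definition token (u : M) : Prop := exists w, w <= u /\ u = pair 1 w.

Definition refutes (v u : M) : Prop :=
  exists i, i <= u /\ exists x, x <= u /\ exists y, y <= u /\ exists z, z <= v /\
    claim u i x y /\ v = pair 1 (pair i (pair x z)) /\ ~ pair i (pair x z) \in T.

(** The bound in a claim is not unique, so claims differing only in it must be joined if each [i] is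
    to add at most one component. *)
Definition same_claim (u v : M) : Prop :=
  exists i, i <= u /\ exists x, x <= u /\ exists y, y <= u /\ exists z, z <= v /\
    claim u i x y /\ claim v i x z.

Definition adjacent (u v : M) : Prop :=
  u <> v /\
  (token u /\ token v \/ same_claim u v \/ refutes u v \/ refutes v u).

Definition vertex (u : M) : Prop :=
  token u \/ exists i, i <= u /\ exists x, x <= u /\ exists y, y <= u /\ claim u i x y.

Lemma claim_bounds (t i x z : M) :
  i <= pair t (pair i (pair x z)) /\ x <= pair t (pair i (pair x z)) /\
  z <= pair t (pair i (pair x z)).
Proof.
assert (H := le_pairr t (pair i (pair x z))).
assert (H' : pair x z <= pair t (pair i (pair x z))).
{ eapply le_trans; [apply le_pairr|exact H]. }
split; [|split].
- exact (le_trans (le_pairl _ _) H).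
- exact (le_trans (le_pairl _ _) H').
- exact (le_trans (le_pairr _ _) H').
Qed.

Lemma zero_neq_one : (0 : M) <> 1.
Proof. intros E; apply (succ_neq0 basic (n := 0)); now rewrite add0l. Qed.

Lemma claim_not_token (u i x y w : M) : claim u i x y -> u <> pair 1 w.
Proof.
intros (-> & _) E; apply pair_inj in E as (E & _); now apply zero_neq_one in E.
Qed.

Lemma claim_inj (u i x y i' x' y' : M) :
  claim u i x y -> claim u i' x' y' -> i = i' /\ x = x'.
Proof.
intros (-> & _) (E & _).
apply pair_inj in E as (_ & [-> [-> _]%pair_inj]%pair_inj); auto.
Qed.

Lemma same_claim_sym (u v : M) : same_claim u v -> same_claim v u.
Proof.
intros (i & _ & x & _ & y & _ & z & _ & Cu & Cv).
assert (Bu := Cu); assert (Bv := Cv).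
destruct Bu as (-> & _), Bv as (-> & _).
exists i; split; [apply claim_bounds|]; exists x; split; [apply claim_bounds|].
exists z; split; [apply claim_bounds|]; exists y; split; [apply claim_bounds|auto].
Qed.

Lemma adjacent_sym (u v : M) : adjacent u v -> adjacent v u.
Proof. unfold adjacent; intuition auto using same_claim_sym. Qed.

Lemma claim_vertex (u i x y : M) : claim u i x y -> vertex u.
Proof.
intros C; right; assert (B := C); destruct B as (-> & _).
exists i; split; [apply claim_bounds|]; exists x; split; [apply claim_bounds|].
exists y; split; [apply claim_bounds|exact C].
Qed.

Lemma token_pair (w : M) : token (pair 1 w).
Proof. exists w; split; [apply le_pairr|reflexivity]. Qed.

Lemma adjacent_vertex (u v : M) : adjacent u v -> vertex u.
Proof.
intros (_ & [(Tu & _)|[H|[H|H]]]).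
- left; exact Tu.
- destruct H as (i & _ & x & _ & y & _ & z & _ & C & _); eauto using claim_vertex.
- destruct H as (i & _ & x & _ & y & _ & z & _ & _ & -> & _).
  left; apply token_pair.
- destruct H as (i & _ & x & _ & y & _ & z & _ & C & _); eauto using claim_vertex.
Qed.

Variables V E : pset M.
Hypothesis mem_V : forall u, u \in V <-> vertex u.
Hypothesis mem_E : forall z, z \in E <-> exists u v, z = pair u v /\ adjacent u v.

Lemma edge_adjacent (u v : M) : pair u v \in E <-> adjacent u v.
Proof.
rewrite mem_E; split; [|eauto].
intros (u' & v' & [<- <-]%pair_inj & H); exact H.
Qed.

Lemma refutation_graph : graph V E.
Proof.
constructor.
- intros z (u & v & -> & H)%mem_E; exists u, v; rewrite !mem_V.
  repeat split; eauto using adjacent_vertex, adjacent_sym.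
- intros u v; rewrite !edge_adjacent; apply adjacent_sym.
- intros u; rewrite edge_adjacent; intros (H & _); auto.
Qed.

Let root : M := pair 1 0.

Lemma adjacent_connected (u v : M) : vertex u -> (u <> v -> adjacent u v) ->
  connected V E u v.
Proof.
intros Hu H; destruct (classic (u = v)) as [<-|Nuv].
- now apply connected_refl, mem_V.
- apply connected_edge; [apply refutation_graph|]; apply edge_adjacent; auto.
Qed.

Lemma token_connected_root (u : M) : token u -> connected V E u root.
Proof.
intros Hu; apply adjacent_connected; [left; exact Hu|].
intros Nu; split; [exact Nu|left; split; [exact Hu|apply token_pair]].
Qed.

Lemma refuted_connected_root (u i x y z : M) :
  claim u i x y -> ~ pair i (pair x z) \in T -> connected V E u root.
Proof.
intros C H; apply connected_trans with (pair 1 (pair i (pair x z)));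
  [apply refutation_graph| |apply token_connected_root, token_pair].
apply adjacent_connected; [now apply claim_vertex in C|].
intros Nu; split; auto; right; right; right.
assert (B := C); destruct B as (-> & _).
exists i; split; [apply claim_bounds|]; exists x; split; [apply claim_bounds|].
exists y; split; [apply claim_bounds|]; exists z; split; [apply claim_bounds|auto].
Qed.

Lemma same_claim_connected (u v i x y z : M) :
  claim u i x y -> claim v i x z -> connected V E u v.
Proof.
intros Cu Cv; apply adjacent_connected; [now apply claim_vertex in Cu|].
intros Nu; split; auto; right; left.
assert (Bu := Cu); assert (Bv := Cv).
destruct Bu as (-> & _), Bv as (-> & _).
exists i; split; [apply claim_bounds|]; exists x; split; [apply claim_bounds|].
exists y; split; [apply claim_bounds|]; exists z; split; [apply claim_bounds|auto].
Qed.

(** If the witnesses differ, the claim with the larger one guarantees a counterexample to the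
    smaller, which links the other claim to a token. *)
Lemma claims_connected (u v i x y x' y' : M) :
  claim u i x y -> claim v i x' y' ->
  connected V E u root \/ connected V E v root \/ connected V E u v.
Proof.
intros Cu Cv; destruct (lt_total x x') as [H|[<-|H]].
- left; destruct Cv as (_ & _ & Cv), (Cv x H) as (z & _ & Hz).
  eauto using refuted_connected_root.
- eauto using same_claim_connected.
- right; left; assert (K := Cu); destruct K as (_ & _ & K), (K x' H) as (z & _ & Hz).
  eauto using refuted_connected_root.
Qed.

(** The claims for this [i] and [x] form a set closed under adjacency, since no token refutes them;
    [root] lies outside it. *)
Lemma correct_claim_not_connected_root (u i x y : M) :
  claim u i x y -> (forall z, pair i (pair x z) \in T) -> ~ connected V E u root.
Proof.
intros C HT K.
destruct (@delta0_comprehension (fun v => exists z, z <= v /\ claim v i x z))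
  as (A & HA); [unfold claim, refuted_below; definable|].
assert (HA' : forall v, v \in A <-> exists z, claim v i x z).
{ intros v; rewrite HA; split; [intros (z & _ & H); eauto|].
  intros (z & H); exists z; split; auto; destruct H as (-> & _); apply claim_bounds. }
apply connected_set with (A := A) in K.
- apply HA' in K as (z & Hz); now apply claim_not_token with (w := 0) in Hz.
- apply HA'; eauto.
- intros v w Hvw%edge_adjacent (z & Hz)%HA'; apply HA'.
  destruct Hvw as (_ & [((t & _ & Ev) & _)|[H|[H|H]]]).
  + now apply claim_not_token with (w := t) in Hz.
  + destruct H as (i' & _ & x' & _ & y' & _ & z' & _ & C1 & C2).
    destruct (claim_inj Hz C1) as (<- & <-); eauto.
  + destruct H as (i' & _ & x' & _ & y' & _ & z' & _ & _ & Ev & _).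
    now apply (claim_not_token Hz) in Ev.
  + destruct H as (i' & _ & x' & _ & y' & _ & z' & _ & C1 & _ & F).
    destruct (claim_inj Hz C1) as (<- & <-); exfalso; apply F, HT.
Qed.

(** The values [i <= N] account for at most [N + 1] components and the tokens for one more, so
    [N + 3] vertices cannot be pairwise disconnected. *)
Lemma refutation_graph_components (X : M) :
  fin_sub X (fun i => i \in V) -> card X (N + 1 + 1 + 1) ->
  exists u v, fin_mem X u /\ fin_mem X v /\ u <> v /\ connected V E u v.
Proof.
intros (CX & SX) (s & (Cs & Ps & Us & Ds) & Is & Hs); apply NNPP; intros NC.
assert (U : forall u v, fin_mem X u -> fin_mem X v -> connected V E u v -> u = v).
{ intros u v Hu Hv C; apply NNPP; intros Nuv; apply NC; eauto 6. }
(* The only member of [X] connected to [root], if there is one; otherwise the default 0 is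
   harmless. *)
assert (K : exists w, forall v, fin_mem X v -> connected V E v root -> v = w).
{ destruct (classic (exists w, fin_mem X w /\ connected V E w root))
    as [(w & Hw & C)|H].
  - exists w; intros v Hv C'; apply U; auto.
    apply connected_trans with root; auto using refutation_graph.
    apply connected_sym; auto using refutation_graph.
  - exists 0; intros v Hv C; exfalso; eauto. }
destruct K as (w & Hw).
(* Pigeonholes: a position holding [w] gets the extra value [N + 1], any other position gets the
   index [j] of its claim. *)
destruct (@delta0_comprehension (fun z => exists a, a <= z /\ exists j, j <= z /\
  z = pair a j /\ (j = N + 1 /\ fin_mem s (pair a w) \/
    exists v, v <= s /\ fin_mem s (pair a v) /\ v <> w /\
    exists x, x <= v /\ exists y, y <= v /\ claim v j x y)))
  as (F & HF); [unfold claim, refuted_below; definable|].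
assert (EF : forall a j, pair a j \in F <->
  (j = N + 1 /\ fin_mem s (pair a w) \/
   exists v x y, fin_mem s (pair a v) /\ v <> w /\ claim v j x y)).
{ intros a j; rewrite HF; split.
  - intros (a' & _ & j' & _ & [<- <-]%pair_inj & [H|H]); auto.
    destruct H as (v & _ & Hv & Nv & x & _ & y & _ & H); eauto 8.
  - intros H; apply pair_le; exists a, j; split; [reflexivity|].
    destruct H as [H|(v & x & y & Hv & Nv & C)]; auto.
    right; exists v; split; [eauto using lt_le, fin_mem_pair_ltr|].
    repeat (split; [assumption|]); assert (B := C); destruct B as (-> & _).
    exists x; split; [apply claim_bounds|]; exists y; split; [apply claim_bounds|auto]. }
assert (NR : forall a v, fin_mem s (pair a v) -> v <> w -> ~ connected V E v root).
{ intros a v Hv Nv C; apply Nv, Hw; auto; apply Hs; eauto. }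
apply (@pigeonhole F (N + 1 + 1) (N + 1 + 1 + 1)); [apply le_refl| |].
- intros a (v & Hv)%Ds; destruct (classic (v = w)) as [->|Nv].
  + exists (N + 1); split; [apply le_refl|]; apply EF; auto.
  + assert (Vv : vertex v) by (apply mem_V, SX, Hs; eauto).
    destruct Vv as [Tv|(j & _ & x & _ & y & _ & C)].
    * exfalso; apply (NR a v Hv Nv); now apply token_connected_root.
    * exists j; split; [apply lt_le, C|]; apply EF; eauto 7.
- intros a b j _ _ _ Ha%EF Hb%EF.
  assert (NJ : forall v x y, claim v (N + 1) x y -> False).
  { intros v x y (_ & H & _); now apply lt_irrefl in H. }
  destruct Ha as [(-> & Ha)|(u & x & y & Ha & Nu & Cu)],
    Hb as [(E1 & Hb)|(v & x' & y' & Hb & Nv & Cv)]; subst; eauto;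
    try (exfalso; eapply NJ; eassumption).
  destruct (claims_connected Cu Cv) as [H|[H|H]].
  + exfalso; exact (NR a u Ha Nu H).
  + exfalso; exact (NR b v Hb Nv H).
  + apply U in H; [subst; eauto| |]; apply Hs; eauto.
Qed.

(** A least witness is found without the Sigma^0_2 least number principle: if every claim were
    incorrect, Sigma^0_1 induction would refute all candidates below any [x], among them the true
    witness [x0]. *)
Lemma correct_claim_exists (i : M) :
  i <= N -> (exists x, forall y, pair i (pair x y) \in T) ->
  exists u x y, claim u i x y /\ forall z, pair i (pair x z) \in T.
Proof.
intros Hi (x0 & H0); apply NNPP; intros NC.
assert (K : forall x, exists b, refuted_below i x b).
{ apply sigma1_induction; [unfold refuted_below; definable| |].
  - exists 0; intros x Hx; now apply not_lt0 in Hx.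
  - intros x (b & IH).
    (* The bound [b] turns [x] into a claim, which by assumption is incorrect. *)
    assert (R : exists z, ~ pair i (pair x z) \in T).
    { apply not_all_ex_not; intros H; apply NC.
      exists (pair 0 (pair i (pair x b))), x, b; repeat split; auto. }
    destruct R as (z & Hz); exists (b + z + 1); intros x' [Hx| ->]%le_lteq.
    + destruct (IH x' Hx) as (y & Hy & Hxy); exists y; split; auto.
      apply lt_le_trans with b; auto; apply le_exists; exists (z + 1); ring.
    + exists z; split; auto; apply le_addl. }
destruct (K (x0 + 1)) as (b & Hb), (Hb x0 (le_refl x0)) as (y & _ & Hy).
apply Hy, H0.
Qed.

(** Truth at [i] means that some claim about [i] avoids the component of the tokens, and [h] detects
    this by a value other than [c0], the value at [root]. *)
Lemma sigma2_as_sigma1 (h : pset M) (c0 i : M) :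
  decomposition V E h -> pair root c0 \in h -> i <= N ->
  (exists x, forall y, pair i (pair x y) \in T) <->
  exists w, exists u, u <= w /\ exists c, c <= w /\
    exists x, x <= u /\ exists y, y <= u /\ claim u i x y /\ pair u c \in h /\ c <> c0.
Proof.
intros (Fh & Dh) H0 Hi.
assert (Vr : root \in V) by (apply mem_V; left; apply token_pair).
split.
- intros (u & x & y & C & HT)%correct_claim_exists; auto.
  assert (Vu : u \in V) by (apply mem_V; now apply claim_vertex in C).
  destruct (proj2 Fh u Vu) as (c & Hc & _).
  assert (B := C); destruct B as (Eu & _).
  exists (u + c), u; split; [apply le_addr|]; exists c; split; [apply le_addl|].
  exists x; split; [rewrite Eu; apply claim_bounds|].
  exists y; split; [rewrite Eu; apply claim_bounds|].
  repeat (split; [assumption|]); intros Ec.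
  apply (correct_claim_not_connected_root C HT).
  now apply (Dh u root c c0).
- intros (w & u & _ & c & _ & x & _ & y & _ & C & Hc & Nc).
  exists x; intros z; apply NNPP; intros Hz; apply Nc.
  apply (Dh u root c c0); auto; [apply mem_V; now apply claim_vertex in C|].
  now apply refuted_connected_root with i x y z.
Qed.

End RefutationGraph.

Lemma sigma2_induction_of_decompositions :
  finite_component_graphs_decompose M -> ISigma0 2 M.
Proof.
intros HD phi rho sigma S2 H0 HS N.
inversion S2 as [|k phi1 P1]; subst.
inversion P1 as [|k theta S0]; subst.
inversion S0 as [theta' B|]; subst.
destruct (bounded_formula_set rho sigma B) as (T & HT).
assert (ET : forall i, sat (scons i rho) sigma (Ex (All theta)) <->
                       exists x, forall y, pair i (pair x y) \in T).
{ intros i; cbn; split; intros (x & Hx); exists x; intros y; apply HT, Hx. }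
destruct (@delta0_comprehension (vertex T N)) as (V & HV).
{ unfold vertex, token, claim, refuted_below; definable. }
destruct (@delta0_comprehension (fun z => exists u, u <= z /\ exists v, v <= z /\
  z = pair u v /\ adjacent T N u v)) as (E & HE).
{ unfold adjacent, same_claim, refutes, token, claim, refuted_below; definable. }
assert (HE' : forall z, z \in E <-> exists u v, z = pair u v /\ adjacent T N u v).
{ intros z; rewrite HE, <- pair_le; reflexivity. }
destruct (HD (N + 1 + 1 + 1) V E) as (h & Dh).
- exact (refutation_graph HV HE').
- exact (refutation_graph_components HV HE').
- destruct (proj2 (proj1 Dh) (pair 1 0)) as (c0 & Hc0 & _).
  { apply HV; left; apply token_pair. }
  (* The graph was built for the number [N] at which the conclusion is wanted, so the translated
     Sigma^0_1 induction runs only up to [N]. *)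
  assert (K : forall i, exists w, i <= N ->
    exists u, u <= w /\ exists c, c <= w /\ exists x, x <= u /\ exists y, y <= u /\
      claim T N u i x y /\ pair u c \in h /\ c <> c0).
  { apply sigma1_induction.
    - unfold claim, refuted_below; definable.
    - apply ET, (sigma2_as_sigma1 HV HE' Dh Hc0 (le0 N)) in H0 as (w & Hw); eauto.
    - intros i (w & IH).
      destruct (classic (i + 1 <= N)) as [Hi|Hi]; [|exists 0; tauto].
      assert (Hi' : i <= N) by now apply lt_le, lt_cancel_succ.
      assert (Si : sat (scons i rho) sigma (Ex (All theta))).
      { apply ET, (sigma2_as_sigma1 HV HE' Dh Hc0 Hi'); eauto. }
      apply HS, ET, (sigma2_as_sigma1 HV HE' Dh Hc0 Hi) in Si as (w' & Hw'); eauto. }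
  destruct (K N) as (w & Hw).
  apply ET, (sigma2_as_sigma1 HV HE' Dh Hc0 (le_refl N)); eauto using le_refl.
Qed.

End Model.

(** * The three implications combined, for structures that may lack sets *)

Theorem theorem1p5 (M : L2structure) (HM : RCA0 M) :
  (finite_rank_ematroids_have_bases M <-> finite_component_graphs_decompose M) /\
  (finite_component_graphs_decompose M <-> ISigma0 2 M).
Proof.
(* [Model] requires an inhabited sort of sets. Each conclusion supplies a set of its own: the ground
   set [E], the vertex set [V], or a value of the assignment [sigma]. *)
assert (H31 : ISigma0 2 M -> finite_rank_ematroids_have_bases M).
{ intros IS n E.
  exact (@bases_of_sigma2_induction M (Build_Model HM (inhabits E)) IS n E). }
assert (H12 : finite_rank_ematroids_have_bases M -> finite_component_graphs_decompose M).
{ intros HB n V.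
  exact (@decompositions_of_bases M (Build_Model HM (inhabits V)) HB n V). }
assert (H23 : finite_component_graphs_decompose M -> ISigma0 2 M).
{ intros HD phi rho sigma.
  exact (@sigma2_induction_of_decompositions M
    (Build_Model HM (inhabits (sigma O))) HD phi rho sigma). }
tauto.
Qed.
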